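(* Suppose the parallel server system satisfies the relaxed heavy traffic condition and the relaxed complete resource pooling condition, let $(v,u)$ be the unique optimal dual LP solution and let $d_{ik}=u_k-\mu_{ik}v_i$. Under the WWTA policy and a non-idling scheduling policy $\mathcal{P}$, for any non-basic activity $(i,k)$ with $d_{ik}>0$, as $r\downarrow0$, $$\mathbb{E}\Big[\Big(\sum_{k'=1}^Ku_{k'}W_{k'}(Z^{(r)})\Big)\mathbf{1}\big(k=L^{(i)}(Z^{(r)})\big)\Big]=O(r^{1/2}),$$ $$\mathbb{E}\Big[P_{ik}(Z^{(r)})\Big(\sum_{k'=1}^Ku_{k'}W_{k'}(Z^{(r)})\Big)\Big]=O(r^{1/2}).$$ Moreover, $$r\,\mathbb{E}\Big[\sum_{i=1}^I\ \sum_{k\in\mathcal{K}(i):\,d_{ik}>0}v_iZ^{(r)}_{ik}\Big]=O(r^{1/2}).$$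
   Context: Model. Job classes $\mathcal{I}=\{1,\ldots,I\}$, servers $\mathcal{K}=\{1,\ldots,K\}$, and a set $\mathcal{J}\subset\mathcal{I}\times\mathcal{K}$ of $J$ activities ($(i,k)\in\mathcal{J}$ means server $k$ can process class $i$). $\mathcal{I}(k)=\{i:(i,k)\in\mathcal{J}\}$, $\mathcal{K}(i)=\{k:(i,k)\in\mathcal{J}\}$. Class $i$ has nominal arrival rate $\lambda_i>0$ (Poisson arrivals); service times for activity $(i,k)$ are exponential with mean $m_{ik}=1/\mu_{ik}$, $\mu_{ik}>0$. LP (static allocation problem): minimize $\rho$ over $x=(x_{ik})_{(i,k)\in\mathcal{J}}\ge 0$, $\rho\ge0$, subject to $\sum_{k\in\mathcal{K}(i)}\mu_{ik}x_{ik}=\lambda_i$ for all $i$, and $\sum_{i\in\mathcal{I}(k)}x_{ik}\le\rho$ for all $k$. Dual LP: maximize $\sum_i\lambda_iv_i$ over $v\in\mathbb{R}^I$, $u\in\mathbb{R}^K$, $u\ge0$, subject to $\mu_{ik}v_i\le u_k$ for all $(i,k)\in\mathcal{J}$ and $\sum_ku_k\le1$. Relaxed heavy traffic condition: the LP has an optimal solution $(x^*,\rho^* )$ (not necessarily unique) with $\rho^*=1$ and $\sum_{i\in\mathcal{I}(k)}x^*_{ik}=1$ for every $k$. Activity $(i,k)$ is basic associated with such an $x^*$ if $x^*_{ik}>0$; it is non-basic if $x^*_{ik}=0$ for every optimal solution (by complementary slackness, $d_{ik}>0$ implies non-basic). Servers $k,k'$ communicate directly if for some such $x^*$ and some class $i$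 both $(i,k)$ and $(i,k')$ are basic activities associated with $x^*$; servers $k,k'$ communicate if there is a sequence $k=k_1,\ldots,k_\omega=k'$ with consecutive servers communicating directly. Relaxed complete resource pooling condition: such an $x^*$ exists and all servers communicate (different links may use different optimal $x^*$). Under these two conditions the dual LP has a unique optimal solution $(v,u)$, with all $u_k>0$, $v_i>0$. Policies. A state is $z=(z_{ik})_{(i,k)\in\mathcal{J}}\in\mathbb{Z}_+^J$, $z_{ik}$ being the number of jobs in buffer $(i,k)$ (including in service). Workload: $W_k(z)=\sum_{i\in\mathcal{I}(k)}m_{ik}z_{ik}$. WWTA routing: a class $i$ arrival in state $z$ is immediately routed to server $L^{(i)}(z)$, the smallest index in $\arg\min_{k\in\mathcal{K}(i)}m_{ik}W_k(z)$. A non-idling scheduling policy $\mathcal{P}=(P_{ik}(z))$ gives the fraction $P_{ik}(z)\in[0,1]$ of effort of server $k$ devoted to class $i$ in state $z$, with $P_{ik}(z)=0$ if $z_{ik}=0$ and $\sum_{i\in\mathcal{I}(k)}P_{ik}(z)=1$ whenever $\sum_{i\in\mathcal{I}(k)}z_{ik}>0$. Sequence of systems. For $r\in(0,1)$, the $r$th system has arrival rates $\lambda_i^{(r)}=\lambda_i(1-r)$, other parameters unchanged. Its queue length process is the continuous-time Markov chain on $\mathbb{Z}_+^J$ with generator $$Gf(z)=\sum_{i}\lambda_i^{(r)}\sum_{k\in\mathcal{K}(i)}[f(z+e_{ik})-f(z)]\mathbf{1}(k=L^{(i)}(z))+\sum_k\sum_{i\in\mathcal{I}(k)}\mu_{ik}P_{ik}(z)[f(z-e_{ik})-f(z)],$$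 $e_{ik}$ the unit vectors. For each $r\in(0,1)$ it has a unique stationary distribution; $Z^{(r)}$ denotes a random vector with this distribution. $f(r)=O(g(r))$ means $\limsup_{r\downarrow0}|f(r)/g(r)|<\infty$. *)

(* Defs.v *)
From HB Require Import structures.
From mathcomp Require Import all_boot all_order all_algebra.
From mathcomp Require Import all_classical all_reals all_analysis.
From Stdlib Require Import Relations.Relation_Operators.

Set Implicit Arguments.
Unset Strict Implicit.
Unset Printing Implicit Defensive.

Import Order.TTheory GRing.Theory Num.Theory.
Import numFieldNormedType.Exports.

Local Open Scope classical_set_scope.
Local Open Scope ring_scope.

(* The activities (i, k) \in J are a finite type, so that quantities indexed
   by J (x, mu, m, d, z, P) are functions on [activity J] and carry no junk
   values off J.  A sum over I(k) is a sum over the activities with server k, a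
   sum over K(i) is a sum over the activities with class i. *)
Definition activity (nI nK : nat) (J : {set 'I_nI * 'I_nK}) :=
  {a : 'I_nI * 'I_nK | a \in J}.

Definition cls (nI nK : nat) (J : {set 'I_nI * 'I_nK}) (a : activity J) : 'I_nI :=
  (val a).1.

Definition srv (nI nK : nat) (J : {set 'I_nI * 'I_nK}) (a : activity J) : 'I_nK :=
  (val a).2.

Section LinearPrograms.
Variables (R : realType) (nI nK : nat) (J : {set 'I_nI * 'I_nK}).
Variables (lam : 'I_nI -> R) (mu : activity J -> R).

Definition lp_feasible (x : activity J -> R) (rho : R) : Prop :=
  [/\ forall a, 0 <= x a,
      0 <= rho,
      forall i, \sum_(a : activity J | cls a == i) mu a * x a = lam i
    & forall k, \sum_(a : activity J | srv a == k) x a <= rho].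

Definition lp_optimal (x : activity J -> R) (rho : R) : Prop :=
  lp_feasible x rho /\ forall x' rho', lp_feasible x' rho' -> rho <= rho'.

Definition dual_feasible (v : 'I_nI -> R) (u : 'I_nK -> R) : Prop :=
  [/\ forall k, 0 <= u k,
      forall a : activity J, mu a * v (cls a) <= u (srv a)
    & \sum_k u k <= 1].

Definition dual_optimal (v : 'I_nI -> R) (u : 'I_nK -> R) : Prop :=
  dual_feasible v u /\
  forall v' u', dual_feasible v' u' ->
    \sum_i lam i * v' i <= \sum_i lam i * v i.

Definition heavy_traffic_solution (x : activity J -> R) : Prop :=
  lp_optimal x 1 /\ forall k, \sum_(a : activity J | srv a == k) x a = 1.

Definition relaxed_heavy_traffic : Prop := exists x, heavy_traffic_solution x.

Definition basic (x : activity J -> R) (a : activity J) : Prop :=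
  heavy_traffic_solution x /\ 0 < x a.

Definition non_basic (a : activity J) : Prop :=
  forall x rho, lp_optimal x rho -> x a = 0.

Definition communicate_directly (k k' : 'I_nK) : Prop :=
  exists (x : activity J -> R) (a b : activity J),
    [/\ cls a = cls b, srv a = k, srv b = k', basic x a & basic x b].

Definition communicate : 'I_nK -> 'I_nK -> Prop :=
  clos_refl_trans 'I_nK communicate_directly.

Definition relaxed_complete_resource_pooling : Prop :=
  relaxed_heavy_traffic /\ forall k k', communicate k k'.

Definition dual_slack (v : 'I_nI -> R) (u : 'I_nK -> R) (a : activity J) : R :=
  u (srv a) - mu a * v (cls a).

End LinearPrograms.

Definition state (nI nK : nat) (J : {set 'I_nI * 'I_nK}) :=
  {ffun activity J -> nat}.

Section StateSpace.
Variables (nI nK : nat) (J : {set 'I_nI * 'I_nK}).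

HB.instance Definition _ := Countable.on (state J).
HB.instance Definition _ :=
  isPointed.Build (state J) [ffun=> 0%N].
HB.instance Definition _ := @isMeasurable.Build default_measure_display
  (state J) (@discrete_measurable _) (@discrete_measurable0 _)
  (@discrete_measurableC _) (@discrete_measurableU _).

Definition add_job (z : state J) (a : activity J) : state J :=
  [ffun b => (z b + (b == a))%N].

(* Truncated at 0; in the generator it is weighted by P_a(z), which vanishes
   when z a = 0. *)
Definition remove_job (z : state J) (a : activity J) : state J :=
  [ffun b => (z b - (b == a))%N].

End StateSpace.

Section Dynamics.
Variables (R : realType) (nI nK : nat) (J : {set 'I_nI * 'I_nK}).
Variables (lam : 'I_nI -> R) (mu : activity J -> R).

Definition mean_service (a : activity J) : R := (mu a)^-1.

Definition workload (z : state J) (k : 'I_nK) : R :=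
  \sum_(a : activity J | srv a == k) mean_service a * (z a)%:R.

Definition weighted_workload (u : 'I_nK -> R) (z : state J) : R :=
  \sum_k u k * workload z k.

Definition wwta_argmin (z : state J) (a : activity J) : bool :=
  [forall b : activity J, (cls b == cls a) ==>
    (mean_service a * workload z (srv a) <= mean_service b * workload z (srv b))].

(* For a = (i, k), this is k = L^(i)(z). *)
Definition wwta_route (z : state J) (a : activity J) : bool :=
  wwta_argmin z a &&
  [forall b : activity J, (cls b == cls a) && wwta_argmin z b ==>
    (srv a <= srv b)%N].

Definition non_idling_policy (P : state J -> activity J -> R) : Prop :=
  [/\ forall (z : state J) (a : activity J), 0 <= P z a <= 1,
      forall (z : state J) (a : activity J), z a = 0%N -> P z a = 0
    & forall (z : state J) (k : 'I_nK), (0 < \sum_(a : activity J | srv a == k) z a)%N ->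
        \sum_(a : activity J | srv a == k) P z a = 1].

Definition generator (P : state J -> activity J -> R) (r : R)
    (f : state J -> R) (z : state J) : R :=
  \sum_i lam i * (1 - r) *
    (\sum_(a : activity J | cls a == i)
       (f (add_job z a) - f z) * (wwta_route z a)%:R) +
  \sum_k \sum_(a : activity J | srv a == k)
    mu a * P z a * (f (remove_job z a) - f z).

End Dynamics.

(* (p t)_(t >= 0) is the transition function of the continuous-time Markov chain
   with generator G; the rate from x to y is G applied to the indicator of y.
   The chains used here have bounded jump rates, so G determines p. *)
Definition ctmc_transition_function (R : realType) (nI nK : nat)
    (J : {set 'I_nI * 'I_nK}) (G : (state J -> R) -> state J -> R)
    (p : R -> R.-pker (state J) ~> (state J)) : Prop :=
  [/\ forall (x : state J) (A : set (state J)), p 0 x A = \d_x A,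
      forall (s t : R) (x : state J) (A : set (state J)), 0 <= s -> 0 <= t ->
        (p (s + t)%R x A = \int[p s x]_y p t y A)%E
    & forall x y : state J,
        (fine (p h x [set y]) - (x == y)%:R) / h @[h --> 0^'+]
          --> G (fun z => (z == y)%:R) x].

Definition stationary (R : realType) (nI nK : nat) (J : {set 'I_nI * 'I_nK})
    (p : R -> R.-pker (state J) ~> (state J)) (nu : probability (state J) R) : Prop :=
  forall (t : R) (A : set (state J)), 0 <= t -> (\int[nu]_x p t x A = nu A)%E.

(* f(r) = O(g(r)) as r decreases to 0, for extended-real f: in particular f is
   finite near 0 whenever g is positive there. *)
Definition bigO_at0 (R : realType) (f : R -> \bar R) (g : R -> R) : Prop :=
  (limf_esup (fun r => `|f r * (g r)^-1%:E|) (0 : R)^'+ < +oo)%E.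

(* Main.v *)
(* Write [W] for the workload vector, [S = u . W], and [w] for the component of [W]
   orthogonal to the server prices [u], which vanishes exactly when all the ratios
   [W_k / u_k] agree.

   - Every optimal allocation of the static problem gives a bound on the drift of
     [Q = |w|^2].  By pooling these bounds together force a drift of order
     [- |w|], uniformly in small [r], so that [E Q = O(1)].
   - By LP duality the drift of [S] is [- r] plus the rate at which value is lost
     by idling and by routing to activities with positive slack; hence the mean
     loss rate is [O(r)].
   - A server which is idle, or to which WWTA routes through an activity of
     positive slack, lies below the common level by an amount proportional to it,
     so [S = O(|w|)] whenever value is lost.  By Young's inequality [S] times the
     loss rate has mean [O(r^(1/2))].
   - The drift of [z_a S] turns this into the bounds on [P_a S] and [r z_a].

   Means under the stationary law are controlled only through Foster's criterion
   for nonnegative test functions, so that no a priori moment bound is needed. *)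

Require Import Defs.
From mathcomp Require Import all_boot all_order all_algebra.
From mathcomp Require Import all_classical all_reals all_analysis.
From mathcomp Require Import measurable_realfun.
From mathcomp Require Import ring lra.

Set Implicit Arguments.
Unset Strict Implicit.
Unset Printing Implicit Defensive.

Import Order.TTheory GRing.Theory Num.Theory.
Import numFieldNormedType.Exports.

Local Open Scope ring_scope.

(** * Stationary laws and Foster's criterion *)

Section MeanBounds.
Variables (R : realType) (nI nK : nat) (J : {set 'I_nI * 'I_nK}).
Implicit Types (f g h : state J -> R) (c e : R).
Variable nu : probability (state J) R.

Lemma measurable_state (f : state J -> \bar R) : measurable_fun [set: state J]%classic f.
Proof. by []. Qed.

(** The integral takes extended real values, so for nonnegative [f] this bound also asserts
    integrability. *)
Definition mean_le f c : Prop := (\int[nu]_z (f z)%:E <= c%:E)%E.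

Lemma mean_le_mono f g c :
  (forall z, 0 <= f z) -> (forall z, f z <= g z) -> mean_le g c -> mean_le f c.
Proof.
move=> f0 fg; apply: le_trans; apply: ge0_le_integral => // z _.
  by rewrite lee_fin (le_trans (f0 z)).
by rewrite lee_fin.
Qed.

Lemma mean_le_weaken f c e : c <= e -> mean_le f c -> mean_le f e.
Proof. by move=> ce /le_trans; apply; rewrite lee_fin. Qed.

Lemma mean_leD f g c e :
  (forall z, 0 <= f z) -> (forall z, 0 <= g z) ->
  mean_le f c -> mean_le g e -> mean_le (fun z => f z + g z) (c + e).
Proof.
move=> f0 g0 fc ge; rewrite /mean_le.
under eq_integral do rewrite EFinD.
by rewrite ge0_integralD// ?EFinD ?leeD// => z _; rewrite lee_fin.
Qed.

Lemma mean_leZ k f c : 0 <= k ->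
  (forall z, 0 <= f z) -> mean_le f c -> mean_le (fun z => k * f z) (k * c).
Proof.
move=> k0 f0 fc; rewrite /mean_le.
under eq_integral do rewrite EFinM.
rewrite ge0_integralZl//; first by rewrite EFinM lee_wpmul2l// lee_fin.
by move=> z _; rewrite lee_fin.
Qed.

Lemma mean_le_cst c : 0 <= c -> mean_le (fun=> c) c.
Proof.
move=> c0; rewrite /mean_le (integral_cst nu measurableT c%:E).
rewrite (_ : (_ * _)%E = c%:E)// -[RHS]mule1; congr (_ * _)%E.
exact: probability_setT.
Qed.

Lemma mean_le_sum (I : Type) (s : seq I) (f : I -> state J -> R) (c : I -> R) :
  (forall i z, 0 <= f i z) -> (forall i, mean_le (f i) (c i)) ->
  mean_le (fun z => \sum_(i <- s) f i z) (\sum_(i <- s) c i).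
Proof.
move=> f0 fc; rewrite /mean_le.
under eq_integral do rewrite -sumEFin.
rewrite ge0_integral_sum//; last by move=> i z _; rewrite lee_fin.
by rewrite -sumEFin; apply: lee_sum => i _; exact: fc.
Qed.

(** Fatou's lemma. It removes truncations and vanishing error terms without any domination. *)
Lemma mean_le_fatou (fn : nat -> state J -> R) f (cn : nat -> R) c :
  (forall n z, 0 <= fn n z) ->
  (forall z, (fn n z @[n --> \oo] --> f z)%classic) ->
  (cn @ \oo --> c)%classic ->
  (forall n, mean_le (fn n) (cn n)) -> mean_le f c.
Proof.
move=> fn0 fnf cnc fncn.
have fE z : limn_einf (fun n => (fn n z)%:E) = (f z)%:E.
  apply: (cvg_limn_einf_sup _).1; apply: cvg_EFin; last exact: fnf.
  exact: nearW.
have := @fatou _ _ _ nu [set: state J]%classic measurableT (fun n z => (fn n z)%:E)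
  (fun n => @measurable_state _) (fun n z _ => fn0 n z).
under eq_integral do rewrite fE.
move=> /le_trans; apply.
suff <- : limn_einf (fun n => (cn n)%:E) = c%:E.
  rewrite !limn_einf_lim; apply: lee_lim; [exact: is_cvg_einfs..|].
  apply: nearW => n; apply: le_ereal_inf_tmp => _ [m /= nm <-].
  by apply: le_trans (fncn m); apply: ereal_inf_lbound; exists m.
by apply: (cvg_limn_einf_sup _).1; apply: cvg_EFin => //; exact: nearW.
Qed.

End MeanBounds.

(** * Foster's criterion for birth-death generators *)

Section BirthDeath.
Variables (R : realType) (nI nK : nat) (J : {set 'I_nI * 'I_nK}).
Variables (al be : state J -> activity J -> R).
Implicit Types (f g h b : state J -> R).

Definition birth_death f z : R :=
  \sum_a (al z a * (f (add_job z a) - f z) + be z a * (f (remove_job z a) - f z)).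

(** The jump part of the generator. Keeping it apart from [total_rate] lets a balance relation
    compare two integrals of nonnegative functions, which are always defined. *)
Definition inflow f z : R :=
  \sum_a (al z a * f (add_job z a) + be z a * f (remove_job z a)).

Definition total_rate z : R := \sum_a (al z a + be z a).

Lemma birth_deathE f z : birth_death f z = inflow f z - total_rate z * f z.
Proof.
rewrite /birth_death /inflow /total_rate mulr_suml -sumrB.
by apply: eq_bigr => a _; ring.
Qed.

Lemma birth_deathDZ f g e z :
  birth_death (fun x => f x + e * g x) z = birth_death f z + e * birth_death g z.
Proof.
rewrite /birth_death mulr_sumr -big_split /=; apply: eq_bigr => a _; ring.
Qed.

Lemma inflow_finsupp (s : seq (state J)) f z :
  inflow (fun x => \sum_(y <- s) f y * (x == y)%:R) z =
  \sum_(y <- s) f y * inflow (fun x => (x == y)%:R) z.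
Proof.
rewrite /inflow; under [RHS]eq_bigr do rewrite mulr_sumr.
rewrite exchange_big /=; apply: eq_bigr => a _.
rewrite !mulr_sumr -big_split /=; apply: eq_bigr => y _; ring.
Qed.

Hypothesis al_ge0 : forall z a, 0 <= al z a.
Hypothesis be_ge0 : forall z a, 0 <= be z a.

Lemma total_rate_ge0 z : 0 <= total_rate z.
Proof. by apply: sumr_ge0 => a _; rewrite addr_ge0. Qed.

Lemma inflow_ge0 f : (forall z, 0 <= f z) -> forall z, 0 <= inflow f z.
Proof. by move=> f0 z; apply: sumr_ge0 => a _; rewrite addr_ge0 ?mulr_ge0. Qed.

Definition njobs (z : state J) : R := \sum_a (z a)%:R.

Lemma birth_death_njobs z : birth_death njobs z <= total_rate z.
Proof.
apply: ler_sum => a _; have := al_ge0 z a; have := be_ge0 z a.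
have -> : njobs (add_job z a) - njobs z = 1.
  rewrite /njobs -sumrB (bigD1 a)//= big1 ?addr0.
    by rewrite ffunE eqxx addn1 -natr1; lra.
  by move=> c /negPf ca; rewrite ffunE ca addn0 subrr.
have : njobs (remove_job z a) - njobs z <= 0.
  rewrite subr_le0; apply: ler_sum => c _; rewrite ler_nat ffunE; exact: leq_subr.
nra.
Qed.

Variable nu : probability (state J) R.

(** Half of the global balance equation at [y]: the probability flow into [y] does not exceed the
    flow out of it. *)
Definition subinvariant : Prop := forall y,
  (\int[nu]_z (inflow (fun x => (x == y)%:R) z)%:E <=
   \int[nu]_z (total_rate z * (z == y)%:R)%:E)%E.

Hypothesis nu_subinv : subinvariant.

(** A nonnegative function of finite support is a finite combination of point indicators. Its
    coefficients must be nonnegative because only an inequality is available at each point. *)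
Lemma subinvariant_finsupp (s : seq (state J)) h : uniq s ->
  (forall z, 0 <= h z) -> (forall z, z \notin s -> h z = 0) ->
  (\int[nu]_z (inflow h z)%:E <= \int[nu]_z (total_rate z * h z)%:E)%E.
Proof.
move=> us h0 hs.
have hE z : h z = \sum_(y <- s) h y * (z == y)%:R.
  have [zs|zs] := boolP (z \in s); last first.
    rewrite (hs _ zs) big_seq big1// => y ys.
    by case: eqVneq ys zs => [->->//|_ _ _]; rewrite mulr0.
  rewrite (bigD1_seq z)//= eqxx mulr1 big1 ?addr0// => y.
  by rewrite eq_sym => /negPf ->; rewrite mulr0.
have ind0 (y x : state J) : 0 <= (x == y)%:R :> R by [].
have inE z : inflow h z = \sum_(y <- s) h y * inflow (fun x => (x == y)%:R) z.
  by rewrite -inflow_finsupp; congr inflow; apply/funext => x; exact: hE.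
have outE z : total_rate z * h z = \sum_(y <- s) h y * (total_rate z * (z == y)%:R).
  by rewrite [in LHS]hE mulr_sumr; apply: eq_bigr => y _; ring.
under eq_integral do rewrite inE -sumEFin.
under [leRHS]eq_integral do rewrite outE -sumEFin.
rewrite !ge0_integral_sum//; last 2 first.
- by move=> y z _; rewrite lee_fin !mulr_ge0 ?total_rate_ge0.
- by move=> y z _; rewrite lee_fin mulr_ge0 ?inflow_ge0.
apply: lee_sum => y _.
under eq_integral do rewrite EFinM.
under [leRHS]eq_integral do rewrite EFinM.
rewrite !ge0_integralZl ?lee_fin//.
- by apply: lee_wpmul2l; [rewrite lee_fin|exact: nu_subinv].
- by move=> z _; rewrite lee_fin mulr_ge0 ?total_rate_ge0.
- by move=> z _; rewrite lee_fin inflow_ge0.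
Qed.

Variable L : R.
Hypothesis total_rateL : forall z, total_rate z <= L.

(** The truncation [h = max(n - f, 0)] has finite support, so subinvariance bounds the mean of its
    drift by 0. Where [f < n], that drift is at least minus the drift of [f], hence at least
    [g - b]; elsewhere [h] vanishes and its drift is nonnegative. Fatou's lemma then removes the
    cutoff [w n]. *)
Lemma foster_sublevel f b g c :
  (forall n : nat, exists s : seq (state J), forall z, f z < n%:R -> z \in s) ->
  (forall z, 0 <= f z) -> (forall z, 0 <= b z) -> (forall z, 0 <= g z) ->
  (forall z, birth_death f z <= b z - g z) ->
  mean_le nu b c -> mean_le nu g c.
Proof.
move=> fin f0 b0 g0 drift bc.
pose w (n : nat) z : R := (f z < n%:R)%R%:R.
suff gw n : mean_le nu (fun z => g z * w n z) c.
  apply: (mean_le_fatou _ _ (cvg_cst c) gw) => [n z|z].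
    by rewrite mulr_ge0.
  apply: cvg_near_cst; near=> n; rewrite /w.
  suff -> : f z < n%:R by rewrite mulr1.
  near: n; exact: nbhs_infty_gtr.
have w0 z : 0 <= w n z by [].
pose h z := Num.max (n%:R - f z) 0.
have h0 z : 0 <= h z by rewrite le_max lexx orbT.
have hle z : h z <= n%:R by rewrite ge_max lerBlDr lerDl f0 ler0n.
have [s hs] := fin n.
have := @subinvariant_finsupp (undup s) h (undup_uniq s) h0.
have hsupp z : z \notin undup s -> h z = 0.
  rewrite mem_undup => zs; apply/eqP; rewrite /h eq_maxr// subr_le0 leNgt.
  by apply: contra zs => /hs.
move=> /(_ hsupp) flow.
have pw z : total_rate z * h z + g z * w n z <= inflow h z + b z.
  suff : g z * w n z - b z <= birth_death h z by rewrite birth_deathE; lra.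
  have hB x y : f x < n%:R -> h y - h x >= - (f y - f x).
    move=> fx; have -> : h x = n%:R - f x by rewrite /h max_l// subr_ge0 ltW.
    have : n%:R - f y <= h y by rewrite le_max lexx.
    lra.
  rewrite /w; have [fz|fz] := ltP (f z) n%:R; last first.
    rewrite mulr0 sub0r (@le_trans _ _ 0) ?oppr_le0//.
    apply: sumr_ge0 => a _; have hz : h z = 0 by apply/max_idPr; rewrite subr_le0.
    by rewrite hz !subr0 addr_ge0 ?mulr_ge0.
  rewrite mulr1; apply: (@le_trans _ _ (- birth_death f z)).
    by have := drift z; lra.
  rewrite /birth_death -sumrN; apply: ler_sum => a _.
  have := al_ge0 z a; have := be_ge0 z a.
  have := hB _ (add_job z a) fz; have := hB _ (remove_job z a) fz; nra.
(* Bounded rates make this integral finite, so that it can be cancelled from both sides. *)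
have hfin : (\int[nu]_z (total_rate z * h z)%:E)%E \is a fin_num.
  rewrite ge0_fin_numE; last first.
    by apply: integral_ge0 => z _; rewrite lee_fin mulr_ge0 ?total_rate_ge0.
  have L0 : 0 <= L by rewrite (le_trans (total_rate_ge0 [ffun=> 0%N])).
  have : mean_le nu (fun z => total_rate z * h z) (L * n%:R).
    apply: (mean_le_mono _ _ (mean_le_cst nu (mulr_ge0 L0 (ler0n _ n)))) => z.
      by rewrite mulr_ge0 ?total_rate_ge0.
    by rewrite ler_pM ?total_rate_ge0.
  by move=> /le_lt_trans; apply; rewrite ltry.
rewrite /mean_le -(leeD2lE _ _ hfin).
rewrite -ge0_integralD//; last 2 first.
- by move=> z _; rewrite lee_fin mulr_ge0 ?total_rate_ge0.
- by move=> z _; rewrite lee_fin mulr_ge0.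
apply: (@le_trans _ _ (\int[nu]_z (inflow h z + b z)%:E)%E).
  apply: ge0_le_integral => // z _; last by rewrite -EFinD lee_fin.
  by rewrite -EFinD lee_fin addr_ge0 ?mulr_ge0 ?total_rate_ge0.
under eq_integral do rewrite EFinD.
rewrite ge0_integralD//; last 2 first.
- by move=> z _; rewrite lee_fin inflow_ge0.
- by move=> z _; rewrite lee_fin.
exact: leeD.
Unshelve. all: by end_near. Qed.

Lemma njobs_sublevel (m : R) :
  exists s : seq (state J), forall z, njobs z < m -> z \in s.
Proof.
pose N := Num.trunc m.
exists [seq [ffun a => val (t a)] | t : {ffun activity J -> 'I_N.+1}] => z zm.
have zN a : (z a < N.+1)%N.
  rewrite -(ltr_nat R); apply: le_lt_trans (truncnS_gt m).
  apply: le_trans (ltW zm); rewrite /njobs (bigD1 a)//= lerDl.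
  by apply: sumr_ge0 => *; exact: ler0n.
apply/mapP; exists [ffun a => Ordinal (zN a)]; first by rewrite mem_enum.
by apply/ffunP => a; rewrite !ffunE.
Qed.

(** Adding [e * njobs] to the test function makes its sublevel sets finite and costs at most [e * L]
    in the drift; then [e] tends to 0. *)
Lemma foster f b g c :
  (forall z, 0 <= f z) -> (forall z, 0 <= b z) -> (forall z, 0 <= g z) ->
  (forall z, birth_death f z <= b z - g z) ->
  mean_le nu b c -> mean_le nu g c.
Proof.
move=> f0 b0 g0 drift bc.
have L0 : 0 <= L by rewrite (le_trans (total_rate_ge0 [ffun=> 0%N])).
have njobs0 z : 0 <= njobs z by apply: sumr_ge0 => *; exact: ler0n.
have eps_bound (n : nat) : mean_le nu g (c + n.+1%:R^-1 * L).
  set e : R := n.+1%:R^-1; have e0 : 0 < e by rewrite invr_gt0.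
  apply: (@foster_sublevel (fun z => f z + e * njobs z) (fun z => b z + e * L)) => //.
  - move=> m; have [s hs] := njobs_sublevel (m%:R / e).
    exists s => z fz; apply: hs; rewrite ltr_pdivlMr// mulrC.
    by apply: le_lt_trans fz; rewrite lerDr.
  - by move=> z; rewrite addr_ge0 ?mulr_ge0// ltW.
  - by move=> z; rewrite addr_ge0 ?mulr_ge0// ltW.
  - move=> z; rewrite birth_deathDZ.
    have := drift z; have := le_trans (birth_death_njobs z) (total_rateL z); nra.
  - have eL : 0 <= e * L by rewrite mulr_ge0// ltW.
    by apply: mean_leD => //; exact: mean_le_cst.
apply: (mean_le_fatou _ _ _ eps_bound) => //; first by move=> z; exact: cvg_cst.
rewrite -[c in X in (_ --> X)%classic]addr0 -(mul0r L).
by apply: cvgD; [exact: cvg_cst | apply: cvgMl; exact: cvg_harmonic].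
Qed.

End BirthDeath.

(** * Stationary laws satisfy the balance inequality *)

Section StationaryBalance.
Variables (R : realType) (nI nK : nat) (J : {set 'I_nI * 'I_nK}).
Variables (al be : state J -> activity J -> R).
Hypothesis al_ge0 : forall z a, 0 <= al z a.
Hypothesis be_ge0 : forall z a, 0 <= be z a.
Variable nu : probability (state J) R.

Lemma probability_fineK (m : probability (state J) R) A : (fine (m A))%:E = m A.
Proof.
rewrite fineK// ge0_fin_numE//.
by apply: le_lt_trans (probability_le1 m _) _ => //; rewrite ltry.
Qed.

Lemma integral_point (k : R) (y : state J) : 0 <= k ->
  (\int[nu]_z (k * (z == y)%:R)%:E = (k * fine (nu [set y]%classic))%:E)%E.
Proof.
move=> k0; under eq_integral do rewrite EFinM.
rewrite ge0_integralZl ?lee_fin//.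
rewrite EFinM probability_fineK; congr (_ * _)%E.
transitivity (\int[nu]_z (\1_[set y]%classic z)%:E)%E.
  apply: eq_integral => z _; rewrite indicE.
  by case: eqVneq => [->|/eqP zy]; [rewrite mem_set | rewrite memNset].
by rewrite integral_indic// setIT.
Qed.

(* Fatou's lemma applied to the difference quotients of [p h x [set y]], which
   are nonnegative away from [y], gives only an inequality; it suffices for
   Foster's criterion. *)
Lemma stationary_subinvariant (G : (state J -> R) -> state J -> R)
    (p : R -> R.-pker (state J) ~> (state J)) :
  (forall f z, G f z = birth_death al be f z) ->
  ctmc_transition_function G p -> stationary p nu ->
  subinvariant al be nu.
Proof.
move=> GE [_ _ p_deriv] p_stat y.
pose h (n : nat) : R := n.+1%:R^-1.
have h_gt0 n : 0 < h n by rewrite invr_gt0.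
pose phi n x := fine (p (h n) x [set y]%classic).
have phiE n x : (p (h n) x [set y]%classic = (phi n x)%:E)%E.
  rewrite /phi fineK// ge0_fin_numE//.
  apply: (@le_lt_trans _ _ (p (h n) x setT)); last by rewrite prob_kernel ltry.
  by apply: le_measure; rewrite ?inE.
have phi0 n x : 0 <= phi n x by rewrite fine_ge0.
pose ind (x : state J) : R := (x == y)%:R.
have phi_cvg x : ((phi n x - (x == y)%:R) / h n @[n --> \oo] --> G ind x)%classic.
  by move/cvg_at_rightP: (p_deriv x y); apply; split => //; exact: cvg_harmonic.
pose N := fine (nu [set y]%classic).
have N0 : 0 <= N by rewrite fine_ge0.
(* Stationarity over the time [h n]: the mass [N] of [y] is made of what arrives from other states
   and of the part [phi n y * N] found at [y] again. Division by [h n] turns both into rates. *)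
have offdiag n : mean_le nu (fun x => phi n x * (x != y)%:R) (N - phi n y * N).
  rewrite /mean_le EFinB leeBrDr// /N -integral_point// -ge0_integralD//; last 2 first.
  - by move=> z _; rewrite lee_fin mulr_ge0.
  - by move=> z _; rewrite lee_fin mulr_ge0.
  rewrite probability_fineK -(p_stat (h n))//; last exact: ltW.
  apply: ge0_le_integral => // z _.
    by rewrite adde_ge0// lee_fin mulr_ge0.
  rewrite phiE -EFinD lee_fin.
  by case: eqVneq => [->|_]; rewrite ?mulr1 ?mulr0 ?addr0 ?add0r.
pose inf := inflow al be ind.
have inf0 z : 0 <= inf z by apply: inflow_ge0 => // x; rewrite ler0n.
have offlim : mean_le nu (fun x => inf x * (x != y)%:R) (N * (total_rate al be y - inf y)).
  apply: (@mean_le_fatou _ _ _ _ _ (fun n x => (h n)^-1 * (phi n x * (x != y)%:R))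
    _ (fun n => (h n)^-1 * (N - phi n y * N))).
  - by move=> n z; rewrite !mulr_ge0// invr_ge0 ltW.
  - move=> z; case: eqVneq (phi_cvg z) => [_ _|zy].
      rewrite mulr0; under eq_fun do rewrite !mulr0; exact: cvg_cst.
    rewrite GE birth_deathE /ind (negPf zy) mulr0 !subr0 mulr1.
    by under eq_fun do rewrite subr0 mulrC -[phi _ _]mulr1.
  - have := phi_cvg y; rewrite eqxx GE birth_deathE {2}/ind eqxx mulr1 => phiy.
    rewrite (_ : (fun n => _) = fun n => (- N) * ((phi n y - 1) / h n)); last first.
      by apply/funext => n; ring.
    rewrite (_ : N * _ = - N * (inf y - total_rate al be y)); last by ring.
    by apply: cvgMr.
  - move=> n; apply: mean_leZ (offdiag n); first by rewrite invr_ge0 ltW.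
    by move=> z; rewrite mulr_ge0.
(* [inf y] may be nonzero, because [remove_job] fixes a state at an empty buffer and [be] is
   arbitrary here. This flow from [y] to itself was subtracted in [offlim] and is now added back. *)
have diag : mean_le nu (fun x => inf y * (x == y)%:R) (inf y * N).
  by rewrite /mean_le integral_point.
have T0 : 0 <= total_rate al be y by exact: total_rate_ge0.
rewrite (_ : (\int[nu]_z (total_rate al be z * _)%:E)%E = (total_rate al be y * N)%:E); last first.
  rewrite -integral_point//; apply: eq_integral => z _.
  by case: eqVneq => [->|_]; rewrite ?mulr0.
have -> : total_rate al be y * N = N * (total_rate al be y - inf y) + inf y * N by ring.
have : mean_le nu (fun x => inf x * (x != y)%:R + inf y * (x == y)%:R)
    (N * (total_rate al be y - inf y) + inf y * N).
  by apply: mean_leD offlim diag => z; rewrite mulr_ge0.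
apply: mean_le_mono => // z.
by case: eqVneq => [->|_]; rewrite ?mulr1 ?mulr0 ?addr0 ?add0r.
Qed.

End StationaryBalance.

(** * The static allocation problem *)

Section Activities.
Variables (nI nK : nat) (J : {set 'I_nI * 'I_nK}).

Lemma sum_cls (R : nmodType) (F : activity J -> R) :
  \sum_i \sum_(a : activity J | cls a == i) F a = \sum_a F a.
Proof. by rewrite [RHS](partition_big (@cls nI nK J) predT). Qed.

Lemma sum_srv (R : nmodType) (F : activity J -> R) :
  \sum_k \sum_(a : activity J | srv a == k) F a = \sum_a F a.
Proof. by rewrite [RHS](partition_big (@srv nI nK J) predT). Qed.

Lemma activity_eq (a b : activity J) : cls a = cls b -> srv a = srv b -> a = b.
Proof.
rewrite /cls /srv => ci cs; apply: val_inj.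
by rewrite [val a]surjective_pairing [val b]surjective_pairing ci cs.
Qed.

End Activities.

(** The squared positive part has slope [2 * max x 0], and its second-order remainder is at most
    [y^2]. *)
Lemma sqr_pos_part_le (R : realDomainType) (x y : R) :
  (Num.max (x + y) 0) ^+ 2 <= (Num.max x 0) ^+ 2 + 2 * Num.max x 0 * y + y ^+ 2.
Proof. by have [] := leP x 0; have [] := leP (x + y) 0; nra. Qed.

(** * Strong duality and positivity of the dual prices *)

Section StaticAllocation.
Variables (R : realType) (nI nK : nat) (J : {set 'I_nI * 'I_nK}).
Variables (lam : 'I_nI -> R) (mu : activity J -> R).
Hypothesis lam_gt0 : forall i, 0 < lam i.
Hypothesis mu_gt0 : forall a, 0 < mu a.
Hypothesis rht : relaxed_heavy_traffic lam mu.

Let meets_demand (x : activity J -> R) : Prop :=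
  (forall a, 0 <= x a) /\
  (forall i, \sum_(a : activity J | cls a == i) mu a * x a = lam i).

Let load (x : activity J -> R) k := \sum_(a : activity J | srv a == k) x a.

Lemma demand_served x i : meets_demand x -> exists2 a, cls a = i & 0 < x a.
Proof.
move=> [x0 xlam]; apply: contrapT => noa.
have : \sum_(a : activity J | cls a == i) mu a * x a = 0.
  apply: big1 => a /eqP ai; apply/eqP; rewrite mulf_eq0 orbC eq_le x0 andbT.
  by rewrite leNgt; apply/orP; left; apply/negP => xa; apply: noa; exists a.
by rewrite xlam => l0; have := lam_gt0 i; rewrite l0 ltxx.
Qed.

Lemma heavy_traffic_demand x : heavy_traffic_solution lam mu x -> meets_demand x.
Proof. by case=> [[[? ? ? ?] ?] ?]. Qed.

(** Otherwise the largest load would be a feasible objective value below the optimum 1. The default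
    0 of the maximum supplies the constraint [0 <= rho]. *)
Lemma overloaded_server x : meets_demand x -> exists k, 1 <= load x k.
Proof.
move=> [x0 xlam]; apply: contrapT => nok.
have load1 k : load x k < 1.
  by rewrite ltNge; apply/negP => ?; apply: nok; exists k.
have [x1 [[_ opt] _]] := rht.
have : 1 <= \big[Num.max/0]_k load x k.
  apply: (opt x); split => // [|k]; first exact: bigmax_ge_id.
  exact: le_bigmax.
by apply/negP; rewrite -ltNge; apply: bigmax_lt.
Qed.

(** Full load on every server rewrites the sum of prices, and the demand equations rewrite the dual
    value. With nonnegative slacks this gives weak duality, and complementary slackness once the
    right side is 0. *)
Lemma weak_duality x v u : heavy_traffic_solution lam mu x ->
  \sum_a x a * dual_slack mu v u a = \sum_k u k - \sum_i lam i * v i.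
Proof.
move=> xht; have [x0 xlam] := heavy_traffic_demand xht; case: xht => _ xload.
rewrite /dual_slack; under eq_bigr do rewrite mulrBr.
rewrite sumrB; congr (_ - _).
  rewrite -sum_srv; apply: eq_bigr => k _.
  rewrite -[RHS]mulr1 -(xload k) mulr_sumr.
  by apply: eq_bigr => a /eqP ->; rewrite mulrC.
rewrite -sum_cls; apply: eq_bigr => i _.
rewrite -xlam mulr_suml; apply: eq_bigr => a /eqP ->; ring.
Qed.

(* For a threshold [t < 1], the positive parts of [load x k - t] at a near
   minimiser [x] of the sum of their squares are, up to normalisation, the
   server prices of a dual feasible point of value at least [t]. *)
Lemma approximate_strong_duality (e : R) : 0 < e -> e < 1 ->
  exists v u, dual_feasible mu v u /\ 1 - e <= \sum_i lam i * v i.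
Proof.
move=> e0 e1.
pose g (x : activity J -> R) k := Num.max (load x k - (1 - e)) 0.
have g0 x k : 0 <= g x k by rewrite le_max lexx orbT.
pose phi x := \sum_k (g x k) ^+ 2.
have phi_ge x : meets_demand x -> e ^+ 2 <= phi x.
  move=> /overloaded_server[k xk]; rewrite /phi (bigD1 k)//=.
  have : e <= g x k by rewrite le_max; apply/orP; left; lra.
  have : 0 <= \sum_(j < nK | j != k) g x j ^+ 2 by apply: sumr_ge0 => *; exact: sqr_ge0.
  nra.
have [xs xs_ht] := rht.
have xs_dem := heavy_traffic_demand xs_ht.
pose Y := \sum_a lam (cls a) / mu a.
have load_bound x k : meets_demand x -> 0 <= load x k <= Y.
  move=> [x0 xlam]; rewrite sumr_ge0//= /load big_mkcond ler_sum//= => a _.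
  have : x a <= lam (cls a) / mu a.
    rewrite ler_pdivlMr// mulrC -xlam (bigD1 a)//= lerDl.
    by apply: sumr_ge0 => b _; rewrite mulr_ge0// ltW.
  by case: ifP => // _; exact/le_trans/x0.
pose B : R := nK%:R * Y ^+ 2.
have B0 : 0 <= B by rewrite mulr_ge0 ?sqr_ge0.
(* [s] is the step of the variation below and [s^2] the tolerance of the near minimiser. Tolerance
   and quadratic error add up to [s^2 * (1 + B) = s * e^2], which is affordable since
   [phi x >= e^2]. *)
pose s := e ^+ 2 / (1 + B).
have B1 : 0 < 1 + B by lra.
have s0 : 0 < s by rewrite divr_gt0// exprn_gt0.
have sB : s * (1 + B) = e ^+ 2 by rewrite /s mulfVK// gt_eqF.
have s1 : s <= 1 by nra.
have [x xdem xmin] : exists2 x, meets_demand x &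
    forall x', meets_demand x' -> phi x < phi x' + s ^+ 2.
  pose S := [set phi x | x in meets_demand]%classic.
  have hS : has_inf S.
    split; first by exists (phi xs); exists xs.
    by exists (e ^+ 2) => _ [x xd <-]; exact: phi_ge.
  have [_ [x xd <-] xlt] := inf_adherent (exprn_gt0 2 s0) hS.
  exists x => // x' x'd; apply: lt_le_trans xlt _; rewrite lerD2r.
  by apply: ge_inf; [case: hS|exists x'].
have phix := phi_ge x xdem.
have gload : \sum_k g x k * (load x k - (1 - e)) = phi x.
  by apply: eq_bigr => k _; rewrite /g; case: leP => _; ring.
(* First-order optimality, tested by moving from [x] towards [x'] by the fraction [s]: at the prices
   [g x], no allocation that meets demand has loads worth less than the constant load [1 - e]. *)
have variation x' : meets_demand x' -> 0 <= \sum_k g x k * (load x' k - (1 - e)).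
  move=> x'dem.
  pose xt a := (1 - s) * x a + s * x' a.
  have xt_dem : meets_demand xt.
    case: xdem x'dem => [x0 xl] [x'0 x'l]; split.
      by move=> a; rewrite addr_ge0// mulr_ge0 ?subr_ge0// ltW.
    move=> i; transitivity ((1 - s) * lam i + s * lam i); last by ring.
    rewrite -{1}xl -x'l !mulr_sumr -big_split /=.
    by apply: eq_bigr => a _; rewrite /xt; ring.
  pose dl k := load x' k - load x k.
  have loadE k : load xt k - (1 - e) = (load x k - (1 - e)) + s * dl k.
    rewrite /dl /load /xt big_split /= -!mulr_sumr; ring.
  have phi_xt : phi xt <= phi x + 2 * s * (\sum_k g x k * dl k) + s ^+ 2 * B.
    have -> : B = \sum_(k < nK) Y ^+ 2 by rewrite sumr_const card_ord -mulr_natl.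
    rewrite !mulr_sumr -!big_split /=; apply: ler_sum => k _.
    rewrite {1}/g loadE; apply: le_trans (sqr_pos_part_le _ _) _.
    have /andP[l0 l1] := load_bound x k xdem.
    have /andP[l'0 l'1] := load_bound x' k x'dem.
    have dlY : dl k ^+ 2 <= Y ^+ 2 by rewrite /dl; nra.
    rewrite exprMn -/(g x k).
    have := ler_wpM2l (sqr_ge0 s) dlY; lra.
  have := xmin _ xt_dem => lt_phi.
  have -> : \sum_k g x k * (load x' k - (1 - e)) = phi x + \sum_k g x k * dl k.
    rewrite -gload -big_split /=; apply: eq_bigr => k _; rewrite /dl; ring.
  set D := \sum_k _ in phi_xt *.
  have : 0 < s * (2 * D + e ^+ 2) by rewrite -sB; lra.
  by rewrite pmulr_rgt0// => ?; nra.
pose T := \sum_k g x k.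
have T0 : 0 < T.
  rewrite lt_def sumr_ge0// andbT; apply/negP => /eqP gT.
  suff : phi x = 0 by move=> phi0; move: phix; rewrite phi0; nra.
  apply: big1 => k _.
  by have /eqP := gT; rewrite psumr_eq0// => /allP/(_ k (mem_index_enum _))/eqP ->; rewrite expr0n.
pose u k := g x k / T.
have u0 k : 0 <= u k by rewrite divr_ge0// ltW.
have best i : exists b, cls b = i /\
    forall a, cls a = i -> u (srv b) / mu b <= u (srv a) / mu a.
  have [a0 /eqP a0i _] := demand_served i xs_dem.
  case: (@arg_minP _ R _ a0 (fun a : activity J => cls a == i)
    (fun a => u (srv a) / mu a) a0i) => b /eqP bi bmin.
  by exists b; split => // a /eqP; exact: bmin.
have [c cP] := boolp.choice best.
exists (fun i => u (srv (c i)) / mu (c i)), u; split.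
  split => //.
    by move=> a; rewrite mulrC -ler_pdivlMr//; have [_] := cP (cls a); exact.
  by rewrite -mulr_suml divff// gt_eqF.
(* Each class is served entirely by its cheapest activity. The priced load of this allocation is [T]
   times the dual value, so the variation inequality becomes the claimed lower bound. *)
pose x' a := if a == c (cls a) then lam (cls a) / mu a else 0.
have sum_x' (F : activity J -> R) i :
    \sum_(a | cls a == i) F a * x' a = F (c i) * (lam i / mu (c i)).
  have [ci _] := cP i.
  rewrite (bigD1 (c i)) ?ci//= /x' ci eqxx big1 ?addr0// => a /andP[/eqP -> /negPf ->].
  by rewrite mulr0.
have /variation : meets_demand x'.
  split=> [a|i]; first by rewrite /x'; case: ifP => // _; rewrite divr_ge0// ltW.
  by rewrite sum_x' mulrC mulfVK// gt_eqF.
under eq_bigr do rewrite mulrBr.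
rewrite sumrB -mulr_suml -/T subr_ge0.
have -> : \sum_k g x k * load x' k = \sum_i T * (lam i * (u (srv (c i)) / mu (c i))).
  transitivity (\sum_a g x (srv a) * x' a).
    rewrite -sum_srv; apply: eq_bigr => k _; rewrite mulr_sumr.
    by apply: eq_bigr => a /eqP ->.
  rewrite -sum_cls; apply: eq_bigr => i _; rewrite sum_x' /u.
  by field; rewrite !gt_eqF.
by rewrite -mulr_sumr ler_pM2l.
Qed.

Variables (v : 'I_nI -> R) (u : 'I_nK -> R).
Hypothesis vu_opt : dual_optimal lam mu v u.

Lemma dual_slack_ge0 a : 0 <= dual_slack mu v u a.
Proof. by case: vu_opt => [[_ vu _] _]; rewrite subr_ge0. Qed.

(** Weak duality bounds the dual value by the sum of prices, which is at most 1; approximate strong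
    duality excludes a value below 1. *)
Lemma dual_values : \sum_i lam i * v i = 1 /\ \sum_k u k = 1.
Proof.
have [[u0 vu u1] opt] := vu_opt; have [x xht] := rht.
have := weak_duality v u xht.
have : 0 <= \sum_a x a * dual_slack mu v u a.
  apply: sumr_ge0 => a _; rewrite mulr_ge0 ?dual_slack_ge0//.
  by have [] := heavy_traffic_demand xht.
suff : 1 <= \sum_i lam i * v i by lra.
rewrite leNgt; apply/negP => lt1.
set V := \sum_i _ in lt1 *.
(* Half the gap makes [1 - e] exceed [V]; the cap keeps [e] below 1. *)
pose e := Num.min ((1 - V) / 2) (2^-1).
have e0 : 0 < e by rewrite lt_min; apply/andP; split; lra.
have e1 : e < 1 by rewrite gt_min; apply/orP; right; lra.
have [v' [u' [feas' val']]] := approximate_strong_duality e0 e1.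
have := opt _ _ feas'; rewrite -/V.
have : e <= (1 - V) / 2 by rewrite ge_min lexx.
lra.
Qed.

Lemma complementary_slackness x a : heavy_traffic_solution lam mu x ->
  0 < x a -> dual_slack mu v u a = 0.
Proof.
move=> xht xa; have [x0 _] := heavy_traffic_demand xht.
have /eqP := weak_duality v u xht; have [-> ->] := dual_values.
rewrite subrr psumr_eq0; last by move=> b _; rewrite mulr_ge0 ?dual_slack_ge0.
move=> /allP/(_ a (mem_index_enum _))/=.
by rewrite mulf_eq0 gt_eqF//= => /eqP.
Qed.

Lemma basic_price x a : heavy_traffic_solution lam mu x -> 0 < x a ->
  mu a * v (cls a) = u (srv a).
Proof.
by move=> xht /(complementary_slackness xht)/eqP; rewrite subr_eq0 => /eqP.
Qed.

Hypothesis rcrp : relaxed_complete_resource_pooling lam mu.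

(** Basic activities have zero slack, so a zero price passes through the common class to a directly
    communicating server. By pooling all prices would then vanish, although they sum to 1. *)
Lemma server_price_gt0 k : 0 < u k.
Proof.
have [[u0 _ _] _] := vu_opt; rewrite lt_def u0 andbT; apply/negP => /eqP uk.
have [_ pool] := rcrp.
have spread k1 k2 : communicate lam mu k1 k2 -> u k1 = 0 -> u k2 = 0.
  elim=> // [k3 k4 [x [a [b [cab <- <- [xht xa] [_ xb]]]]]|k3 k4 k5 _ IH1 _ IH2 u3].
    rewrite -(basic_price xht xa) -(basic_price xht xb) => /eqP.
    by rewrite mulf_eq0 gt_eqF//= cab => /eqP ->; rewrite mulr0.
  by apply: IH2; exact: IH1.
have : \sum_k u k = 0 by apply: big1 => l _; exact: spread (pool k l) uk.
by have [_ ->] := dual_values => /eqP; rewrite oner_eq0.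
Qed.

Lemma class_value_gt0 i : 0 < v i.
Proof.
have [x xht] := rht.
have [a <- xa] := demand_served i (heavy_traffic_demand xht).
by have := server_price_gt0 (srv a); rewrite -(basic_price xht xa) pmulr_rgt0.
Qed.

End StaticAllocation.

(** * Workloads and their imbalance *)

Section Workload.
Variables (R : realType) (nI nK : nat) (J : {set 'I_nI * 'I_nK}).
Variables (mu : activity J -> R) (u : 'I_nK -> R).
Hypothesis mu_gt0 : forall a, 0 < mu a.
Hypothesis u_gt0 : forall k, 0 < u k.
Implicit Types (z : state J) (a b : activity J).

Local Notation m := (mean_service mu).
Local Notation W := (workload mu).
Local Notation S := (weighted_workload mu u).

Lemma mean_service_gt0 a : 0 < m a.
Proof. by rewrite invr_gt0. Qed.

Lemma workload_ge0 z k : 0 <= W z k.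
Proof. by apply: sumr_ge0 => a _; rewrite mulr_ge0// ltW// mean_service_gt0. Qed.

Lemma weighted_workload_ge0 z : 0 <= S z.
Proof. by apply: sumr_ge0 => k _; rewrite mulr_ge0 ?workload_ge0// ltW. Qed.

Lemma workload_add_job z a k : W (add_job z a) k = W z k + m a * (srv a == k)%:R.
Proof.
rewrite /workload; case: (eqVneq (srv a) k) => [ak|ak].
  rewrite (bigD1 a) ?ak//= [in RHS](bigD1 a) ?ak//= ffunE eqxx addn1 -natr1.
  rewrite (eq_bigr (fun b => m b * (z b)%:R)) ?mulr1; first by ring.
  by move=> b /andP[_ /negPf ba]; rewrite ffunE ba addn0.
rewrite mulr0 addr0; apply: eq_bigr => b bk; rewrite ffunE.
by case: (eqVneq b a) => [ba|_]; [rewrite -ba bk in ak | rewrite addn0].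
Qed.

Lemma remove_jobK z a : (0 < z a)%N -> add_job (remove_job z a) a = z.
Proof.
move=> za; apply/ffunP => b; rewrite !ffunE.
by case: eqVneq => [->|_]; rewrite ?subnK ?subn0 ?addn0.
Qed.

Lemma workload_remove_job z a k : (0 < z a)%N ->
  W (remove_job z a) k = W z k - m a * (srv a == k)%:R.
Proof. by move=> za; rewrite -{2}(remove_jobK za) workload_add_job addrK. Qed.

Lemma weighted_workload_shift (x y : 'I_nK -> R) k0 e :
  (forall k, y k = x k + e * (k0 == k)%:R) ->
  \sum_k u k * y k = \sum_k u k * x k + u k0 * e.
Proof.
move=> yx; rewrite (bigD1 k0)//= [in RHS](bigD1 k0)//= yx eqxx mulr1.
rewrite (eq_bigr (fun k => u k * x k)); first by ring.
by move=> k; rewrite yx eq_sym => /negPf ->; rewrite mulr0 addr0.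
Qed.

Lemma weighted_workload_add_job z a : S (add_job z a) = S z + u (srv a) * m a.
Proof. by apply: weighted_workload_shift => k; exact: workload_add_job. Qed.

Lemma weighted_workload_remove_job z a : (0 < z a)%N ->
  S (remove_job z a) = S z - u (srv a) * m a.
Proof.
move=> za; rewrite -mulrN; apply: weighted_workload_shift => k.
by rewrite workload_remove_job// mulNr.
Qed.

Lemma le_weighted_workload z a : u (srv a) * m a * (z a)%:R <= S z.
Proof.
rewrite /weighted_workload (bigD1 (srv a))//= -[leLHS]addr0 lerD//.
  rewrite -mulrA ler_pM2l// /workload (bigD1 a)//= lerDl.
  by apply: sumr_ge0 => b _; rewrite mulr_ge0// ltW// mean_service_gt0.
by apply: sumr_ge0 => k _; rewrite mulr_ge0 ?workload_ge0// ltW.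
Qed.

Let U2 := \sum_k u k ^+ 2.

(** The coefficient of the orthogonal projection of the workload vector on the line spanned by
    [u]. *)
Definition common_level z : R := S z / U2.

(* The component of the workload vector orthogonal to [u]. *)
Definition imbalance z k : R := W z k - common_level z * u k.

Definition sq_imbalance z : R := \sum_k imbalance z k ^+ 2.

Definition abs_imbalance z : R := \sum_k `|imbalance z k|.

Local Notation w := imbalance.
Local Notation Q := sq_imbalance.
Local Notation N1 := abs_imbalance.

Lemma common_level_ge0 z : 0 <= common_level z.
Proof.
by rewrite divr_ge0 ?weighted_workload_ge0//; apply: sumr_ge0 => k _; exact: sqr_ge0.
Qed.

Lemma sq_imbalance_ge0 z : 0 <= Q z.
Proof. by apply: sumr_ge0 => k _; exact: sqr_ge0. Qed.

Lemma abs_imbalance_ge0 z : 0 <= N1 z.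
Proof. by apply: sumr_ge0. Qed.

Lemma le_abs_imbalance z k : `|w z k| <= N1 z.
Proof. by rewrite /N1 (bigD1 k)//= lerDl; exact: sumr_ge0. Qed.

Lemma le_sq_imbalance z k : w z k ^+ 2 <= Q z.
Proof.
by rewrite /Q (bigD1 k)//= lerDl; apply: sumr_ge0 => *; exact: sqr_ge0.
Qed.

Lemma sq_imbalance_le z : Q z <= N1 z ^+ 2.
Proof.
rewrite expr2 {1}/N1 mulr_suml; apply: ler_sum => k _.
by rewrite -real_normK ?num_real// expr2 ler_wpM2l// le_abs_imbalance.
Qed.

Lemma idle_imbalance_le0 z k : W z k = 0 -> w z k <= 0.
Proof.
by move=> Wk; rewrite /w Wk sub0r oppr_le0 mulr_ge0 ?common_level_ge0// ltW.
Qed.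

Lemma sq_price_gt0 (k0 : 'I_nK) : 0 < U2.
Proof.
rewrite /U2 (bigD1 k0)//= ltr_pwDl ?exprn_gt0//.
by apply: sumr_ge0 => *; exact: sqr_ge0.
Qed.

Lemma imbalance_orthogonal z : \sum_k u k * w z k = 0.
Proof.
case: (pickP (@predT 'I_nK)) => [k0 _|none]; last by apply: big1 => k; have := none k.
under eq_bigr do rewrite /w mulrBr (mulrC (common_level z)) mulrA -expr2.
rewrite sumrB -mulr_suml -/U2 /common_level mulrC mulfVK ?subrr//.
by rewrite gt_eqF// (sq_price_gt0 k0).
Qed.

(** The imbalance moves by [e] times the component of the unit vector of [k0] orthogonal to [u]. The
    squared norm of that component is [1 - u k0 ^+ 2 / U2], and orthogonality of [w] to [u] reduces
    the cross term to [w z k0]. *)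
Lemma sq_imbalance_shift z z' k0 e :
  (forall k, W z' k = W z k + e * (k0 == k)%:R) ->
  Q z' = Q z + (2 * e * w z k0 + e ^+ 2 * (1 - u k0 ^+ 2 / U2)).
Proof.
move=> Wz'; have U20 := sq_price_gt0 k0.
have Sz' : common_level z' = common_level z + u k0 * e / U2.
  by rewrite /common_level /weighted_workload (weighted_workload_shift Wz') mulrDl.
have wz' k : w z' k = w z k + e * ((k0 == k)%:R - u k0 / U2 * u k).
  by rewrite /w Sz' Wz'; field; rewrite gt_eqF.
have -> : Q z' = \sum_k (w z k ^+ 2 + 2 * e * ((k0 == k)%:R * w z k)
    - 2 * e * (u k0 / U2) * (u k * w z k)
    + e ^+ 2 * ((k0 == k)%:R * (1 - 2 * (u k0 / U2) * u k))
    + e ^+ 2 * (u k0 / U2) ^+ 2 * u k ^+ 2).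
  by apply: eq_bigr => k _; rewrite wz'; case: eqVneq => _ /=; ring.
have pick (F : 'I_nK -> R) : \sum_k (k0 == k)%:R * F k = F k0.
  rewrite (bigD1 k0)//= eqxx mul1r big1 ?addr0// => k.
  by rewrite eq_sym => /negPf ->; rewrite mul0r.
rewrite !big_split /= sumrN -!mulr_sumr !pick imbalance_orthogonal -/U2.
by rewrite -/(Q z); field; rewrite gt_eqF.
Qed.

Lemma shift_curvature_bound k : 0 <= 1 - u k ^+ 2 / U2 <= 1.
Proof.
have U20 := sq_price_gt0 k.
have : 0 <= u k ^+ 2 / U2 <= 1.
  apply/andP; split; first by rewrite divr_ge0 ?sqr_ge0// ltW.
  rewrite ler_pdivrMr// mul1r [leRHS](bigD1 k)//= lerDl.
  by apply: sumr_ge0 => *; exact: sqr_ge0.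
lra.
Qed.

End Workload.

(** * Drifts under WWTA routing *)

Section Routing.
Variables (R : realType) (nI nK : nat) (J : {set 'I_nI * 'I_nK}).
Variable mu : activity J -> R.

Lemma wwta_route_min z (a b : activity J) : wwta_route mu z a -> cls b = cls a ->
  mean_service mu a * workload mu z (srv a) <= mean_service mu b * workload mu z (srv b).
Proof.
by move=> /andP[/forallP/(_ b)/implyP amin _] ba; apply: amin; rewrite ba.
Qed.

Lemma wwta_route_inj z (a b : activity J) :
  wwta_route mu z a -> wwta_route mu z b -> cls a = cls b -> a = b.
Proof.
move=> /andP[amin /forallP aleast] /andP[bmin /forallP bleast] ab.
apply: activity_eq => //; apply: val_inj; apply/eqP; rewrite eqn_leq.
have := aleast b; rewrite ab eqxx bmin => /= ->.
by have := bleast a; rewrite ab eqxx amin => /= ->.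
Qed.

Lemma wwta_route_exists z i : (exists a : activity J, cls a = i) ->
  exists2 a, cls a = i & wwta_route mu z a.
Proof.
move=> [a0 a0i].
pose c (a : activity J) := mean_service mu a * workload mu z (srv a).
have a0P : cls a0 == i by rewrite a0i.
have [b0 /eqP b0i b0min] := @arg_minP _ R _ a0 (fun a : activity J => cls a == i) c a0P.
have b0arg : wwta_argmin mu z b0.
  by apply/forallP => b; apply/implyP => /eqP bb; apply: b0min; rewrite bb b0i.
have b0P : (cls b0 == i) && wwta_argmin mu z b0 by rewrite b0i eqxx.
have [b /andP[/eqP bi barg] bmin] := @arg_minnP _ b0
  (fun a : activity J => (cls a == i) && wwta_argmin mu z a) (fun a => srv a) b0P.
exists b => //; rewrite /wwta_route barg /=.
by apply/forallP => a; apply/implyP; rewrite bi; exact: bmin.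
Qed.

Lemma sum_wwta_route z i (F : activity J -> R) a :
  cls a = i -> wwta_route mu z a ->
  \sum_(b : activity J | cls b == i) F b * (wwta_route mu z b)%:R = F a.
Proof.
move=> ai aroute; rewrite (bigD1 a) ?ai//= aroute mulr1 big1 ?addr0//.
move=> b /andP[/eqP bi ba]; case: (boolP (wwta_route mu z b)) => [broute|_]; last by rewrite mulr0.
by move: ba; rewrite (wwta_route_inj broute aroute) ?eqxx// bi ai.
Qed.

End Routing.

(* The test functions [h^-1 / (1 + h s)] have slope close to [-1] in [s] but are
   bounded, so that Foster's criterion applies to them. *)
Lemma reciprocal_drop (R : realFieldType) (h s e : R) : 0 < h -> 0 <= s -> 0 <= s + e ->
  h^-1 * (1 + h * (s + e))^-1 - h^-1 * (1 + h * s)^-1 <=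
  - ((1 + h * s)^-1 ^+ 2 * e) + h * e ^+ 2.
Proof.
move=> h0 s0 se0.
have A1 : 1 <= 1 + h * s by rewrite lerDl mulr_ge0// ltW.
have B1 : 1 <= 1 + h * (s + e) by rewrite lerDl mulr_ge0// ltW.
have A0 : 1 + h * s != 0 by rewrite gt_eqF// (lt_le_trans ltr01).
have B0 : 1 + h * (s + e) != 0 by rewrite gt_eqF// (lt_le_trans ltr01).
rewrite (_ : _ - _ = - ((1 + h * s)^-1 ^+ 2 * e) +
    h * e ^+ 2 * ((1 + h * s)^-1 ^+ 2 * (1 + h * (s + e))^-1)); last first.
  by field; rewrite A0 B0 gt_eqF.
rewrite lerD2l -[leRHS]mulr1 ler_wpM2l//.
  by rewrite mulr_ge0 ?sqr_ge0// ltW.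
have unit_inv (y : R) : 1 <= y -> 0 <= y^-1 <= 1.
  move=> y1; have y0 : 0 < y := lt_le_trans ltr01 y1.
  by rewrite invr_ge0 (ltW y0) invf_le1.
have /andP[a0 a1] := unit_inv _ A1; have /andP[b0 b1] := unit_inv _ B1.
by rewrite mulr_ile1 ?sqr_ge0// exprn_ile1.
Qed.

Section Drift.
Variables (R : realType) (nI nK : nat) (J : {set 'I_nI * 'I_nK}).
Variables (lam : 'I_nI -> R) (mu : activity J -> R).
Hypothesis lam_gt0 : forall i, 0 < lam i.
Hypothesis mu_gt0 : forall a, 0 < mu a.
Hypothesis rht : relaxed_heavy_traffic lam mu.
Hypothesis rcrp : relaxed_complete_resource_pooling lam mu.
Variables (v : 'I_nI -> R) (u : 'I_nK -> R).
Hypothesis vu_opt : dual_optimal lam mu v u.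
Variable P : state J -> activity J -> R.
Hypothesis P_policy : non_idling_policy P.
Implicit Types (z : state J) (a b : activity J).

Local Notation m := (mean_service mu).
Local Notation W := (workload mu).
Local Notation S := (weighted_workload mu u).
Local Notation route := (wwta_route mu).
Local Notation d := (dual_slack mu v u).
Local Notation w := (imbalance mu u).
Local Notation Q := (sq_imbalance mu u).
Local Notation N1 := (abs_imbalance mu u).

Let u_gt0 : forall k, 0 < u k := server_price_gt0 lam_gt0 mu_gt0 rht vu_opt rcrp.
Let v_gt0 : forall i, 0 < v i := class_value_gt0 lam_gt0 mu_gt0 rht vu_opt rcrp.
Let m_gt0 : forall a, 0 < m a := mean_service_gt0 mu_gt0.
Let d_ge0 : forall a, 0 <= d a := dual_slack_ge0 vu_opt.

Let mu_m a : mu a * m a = 1.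
Proof. by rewrite mulfV// gt_eqF. Qed.

Lemma price_mean_service a : u (srv a) * m a = v (cls a) + m a * d a.
Proof. by rewrite /dual_slack mulrBr mulrA (mulrC (m a) (mu a)) mu_m; ring. Qed.

(** Testing the workload is equivalent to testing for absence of jobs, as mean service times are
    positive. *)
Definition idle z k : bool := W z k == 0.

Lemma policy_effort z k :
  \sum_(a : activity J | srv a == k) P z a = 1 - (idle z k)%:R.
Proof.
have [P01 P0 P1] := P_policy.
have [busy|] := boolP (0 < \sum_(a : activity J | srv a == k) z a)%N.
  rewrite P1//; suff /negPf -> : ~~ idle z k by rewrite subr0.
  apply: contraL busy => /eqP /eqP Wk; rewrite -leqNgt leqn0 sum_nat_eq0.
  move: Wk; rewrite psumr_eq0; last by move=> a _; rewrite mulr_ge0// ltW.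
  move=> /allP Wk; apply/forallP => a; apply/implyP => ak.
  have := Wk a (mem_index_enum _); rewrite ak mulf_eq0 gt_eqF//=.
  by rewrite pnatr_eq0.
rewrite -leqNgt leqn0 sum_nat_eq0 => /forallP z0.
have za a : srv a == k -> z a = 0%N by move=> ak; have := z0 a; rewrite ak => /eqP.
rewrite big1 => [|a ak]; last by rewrite P0 ?za.
suff -> : idle z k by rewrite subrr.
by rewrite /idle /workload big1// => a ak; rewrite za ?mulr0.
Qed.

Lemma sum_effort z (F : 'I_nK -> R) :
  \sum_a P z a * F (srv a) = \sum_k F k - \sum_k F k * (idle z k)%:R.
Proof.
rewrite -sum_srv -sumrB; apply: eq_bigr => k _.
transitivity ((\sum_(a : activity J | srv a == k) P z a) * F k).
  by rewrite mulr_suml; apply: eq_bigr => a /eqP ->.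
by rewrite policy_effort; ring.
Qed.

Lemma class_served i : exists a : activity J, cls a = i.
Proof.
have [x xht] := rht.
have [a ai _] := demand_served lam_gt0 i (heavy_traffic_demand xht).
by exists a.
Qed.

Lemma sum_routed z (F : 'I_nI -> R) : \sum_a F (cls a) * (route z a)%:R = \sum_i F i.
Proof.
rewrite -sum_cls; apply: eq_bigr => i _.
have [a ai aroute] := wwta_route_exists mu z (class_served i).
by rewrite (sum_wwta_route (fun b => F (cls b)) ai aroute) ai.
Qed.

(* The rate at which work, valued at the server prices, is inflated by routing
   jobs to activities with positive dual slack. *)
Definition waste z : R := \sum_a lam (cls a) * (m a * d a) * (route z a)%:R.

Definition idleness z : R := \sum_k u k * (idle z k)%:R.

Lemma waste_ge0 z : 0 <= waste z.
Proof.
by apply: sumr_ge0 => a _; rewrite !mulr_ge0// ltW.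
Qed.

Lemma idleness_ge0 z : 0 <= idleness z.
Proof. by apply: sumr_ge0 => k _; rewrite mulr_ge0// ltW. Qed.

Lemma idleness_le1 z : idleness z <= 1.
Proof.
have [_ <-] := dual_values lam_gt0 mu_gt0 rht vu_opt.
apply: ler_sum => k _; rewrite -[leRHS]mulr1 ler_wpM2l ?(ltW (u_gt0 k))//.
by case: idle.
Qed.

Let waste_bound := \sum_a lam (cls a) * (m a * d a).

Lemma waste_le z : waste z <= waste_bound.
Proof.
apply: ler_sum => a _; rewrite -[leRHS]mulr1 ler_wpM2l//; last by case: route.
by rewrite !mulr_ge0// ltW.
Qed.

Variable r : R.
Hypothesis r_gt0 : 0 < r.
Hypothesis r_le : r <= 2^-1.

Let r_compl_ge0 : 0 <= 1 - r.
Proof. by have := r_le; lra. Qed.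

Definition arrival_rate z a : R := lam (cls a) * (1 - r) * (route z a)%:R.

Definition service_rate z a : R := mu a * P z a.

Local Notation al := arrival_rate.
Local Notation be := service_rate.
Local Notation G := (birth_death al be).

Lemma generatorE f z : generator lam mu P r f z = G f z.
Proof.
rewrite /generator /birth_death big_split /=; congr (_ + _).
  rewrite -sum_cls; apply: eq_bigr => i _; rewrite mulr_sumr.
  by apply: eq_bigr => a /eqP ai; rewrite /arrival_rate ai; ring.
by rewrite -sum_srv.
Qed.

Lemma arrival_rate_ge0 z a : 0 <= al z a.
Proof. by rewrite !mulr_ge0// ltW. Qed.

Lemma service_rate_ge0 z a : 0 <= be z a.
Proof.
have [P01 _ _] := P_policy; have /andP[P0 _] := P01 z a.
by rewrite mulr_ge0// ltW.
Qed.

Lemma service_rate_empty z a : z a = 0%N -> be z a = 0.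
Proof. by have [_ P0 _] := P_policy => za; rewrite /service_rate P0 ?mulr0. Qed.

Definition rate_bound : R := \sum_a (lam (cls a) + mu a).

Lemma total_rate_le z : total_rate al be z <= rate_bound.
Proof.
apply: ler_sum => a _; apply: lerD.
  have := r_gt0; have := r_le; have := lam_gt0 (cls a).
  by rewrite /arrival_rate; case: route => /=; nra.
have [P01 _ _] := P_policy; have /andP[_ P1] := P01 z a.
by rewrite -[leRHS]mulr1 ler_wpM2l// ltW.
Qed.

Lemma rate_bound_ge0 : 0 <= rate_bound.
Proof. by apply: sumr_ge0 => a _; rewrite addr_ge0// ltW. Qed.

(** The departure estimate is required only at nonempty buffers: at an empty one [remove_job] is
    truncated, but the service rate is 0. *)
Lemma birth_death_le (f : state J -> R) (e1 e2 : activity J -> R) z :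
  (forall a, f (add_job z a) - f z <= e1 a) ->
  (forall a, (0 < z a)%N -> f (remove_job z a) - f z <= e2 a) ->
  G f z <= \sum_a (al z a * e1 a + be z a * e2 a).
Proof.
move=> fadd frem; apply: ler_sum => a _; apply: lerD.
  by rewrite ler_wpM2l ?arrival_rate_ge0.
have [za|za] := posnP (z a); first by rewrite service_rate_empty ?mul0r.
by rewrite ler_wpM2l ?service_rate_ge0 ?frem.
Qed.

Lemma birth_death_eq (f : state J -> R) (e1 e2 : activity J -> R) z :
  (forall a, f (add_job z a) - f z = e1 a) ->
  (forall a, (0 < z a)%N -> f (remove_job z a) - f z = e2 a) ->
  G f z = \sum_a (al z a * e1 a + be z a * e2 a).
Proof.
move=> fadd frem; apply: eq_bigr => a _; rewrite fadd; congr (_ + _).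
by have [za|za] := posnP (z a); [rewrite service_rate_empty ?mul0r | rewrite frem].
Qed.

Lemma net_flow z (F : activity J -> R) :
  \sum_a (al z a * F a - be z a * F a) =
  (1 - r) * (\sum_a lam (cls a) * F a * (route z a)%:R) - \sum_a P z a * (mu a * F a).
Proof.
by rewrite sumrB; congr (_ - _); rewrite ?mulr_sumr; apply: eq_bigr => a _;
  rewrite /arrival_rate /service_rate; ring.
Qed.

Definition loss_rate z : R := (1 - r) * waste z + idleness z.

Lemma loss_rate_ge0 z : 0 <= loss_rate z.
Proof. by rewrite addr_ge0 ?idleness_ge0// mulr_ge0 ?waste_ge0. Qed.

(** This is the drift of [S]. Arrivals bring value [(1 - r) * (1 + waste z)] and service removes
    [1 - idleness z], because the optimal dual value and the sum of prices are both 1. *)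
Lemma net_flow_price z :
  \sum_a (al z a * (u (srv a) * m a) - be z a * (u (srv a) * m a)) = loss_rate z - r.
Proof.
have [lv1 u1] := dual_values lam_gt0 mu_gt0 rht vu_opt.
rewrite net_flow.
have -> : \sum_a lam (cls a) * (u (srv a) * m a) * (route z a)%:R = 1 + waste z.
  transitivity (\sum_i lam i * v i + waste z); last by rewrite lv1.
  rewrite -(sum_routed z) -big_split /=; apply: eq_bigr => a _.
  by rewrite price_mean_service; ring.
have -> : \sum_a P z a * (mu a * (u (srv a) * m a)) = 1 - idleness z.
  transitivity (\sum_a P z a * u (srv a)); last by rewrite sum_effort u1.
  by apply: eq_bigr => a _; congr (_ * _); rewrite mulrCA mu_m mulr1.
by rewrite /loss_rate; ring.
Qed.

(** * Drift of the squared imbalance and state space collapse *)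

Definition sum_sq_service : R := \sum_a m a ^+ 2.

Lemma le_sum_sq_service a : m a ^+ 2 <= sum_sq_service.
Proof.
rewrite /sum_sq_service (bigD1 a)//= lerDl.
by apply: sumr_ge0 => *; exact: sqr_ge0.
Qed.

Lemma sum_sq_service_ge0 : 0 <= sum_sq_service.
Proof. by apply: sumr_ge0 => *; exact: sqr_ge0. Qed.

(** The least [m a * W] within the class: the routing indicator selects exactly one activity, and it
    attains the minimum. *)
Definition class_min z i : R :=
  \sum_(a : activity J | cls a == i) m a * W z (srv a) * (route z a)%:R.

Lemma class_min_le z b : class_min z (cls b) <= m b * W z (srv b).
Proof.
have [a ab aroute] := wwta_route_exists mu z (class_served (cls b)).
rewrite /class_min (sum_wwta_route (fun c => m c * W z (srv c)) ab aroute).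
exact: wwta_route_min.
Qed.

(** The excess of the workloads over the levels at which all activities of a class would tie under
    WWTA, weighted by an allocation. All terms are nonnegative when [x] is. *)
Definition spread (x : activity J -> R) z : R :=
  \sum_a x a * (W z (srv a) - mu a * class_min z (cls a)).

Lemma spread_term_ge0 z a : 0 <= W z (srv a) - mu a * class_min z (cls a).
Proof.
have := ler_wpM2l (ltW (mu_gt0 a)) (class_min_le z a).
by rewrite mulrA mu_m mul1r subr_ge0.
Qed.

Lemma spread_ge0 x z : (forall a, 0 <= x a) -> 0 <= spread x z.
Proof. by move=> x0; apply: sumr_ge0 => a _; rewrite mulr_ge0 ?spread_term_ge0. Qed.

Lemma weighted_class_min x z : heavy_traffic_solution lam mu x ->
  \sum_i lam i * class_min z i = \sum_k W z k - spread x z.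
Proof.
move=> xht; have [_ xlam] := heavy_traffic_demand xht; have [_ xload] := xht.
rewrite /spread; under [X in _ = _ - X]eq_bigr do rewrite mulrBr.
rewrite sumrB opprB [RHS]addrC.
have -> : \sum_a x a * W z (srv a) = \sum_k W z k.
  rewrite -sum_srv; apply: eq_bigr => k _.
  rewrite -[RHS]mul1r -(xload k) mulr_suml.
  by apply: eq_bigr => a /eqP ->.
rewrite subrK -sum_cls; apply: eq_bigr => i _.
by rewrite -xlam mulr_suml; apply: eq_bigr => a /eqP ->; ring.
Qed.

(** Passing from [W] to [w] subtracts [beta * (u * m)] for each routed job, which is at least
    [beta * v] by dual feasibility; the rates [lam] weight the values [v] to a total of 1. *)
Lemma routed_imbalance z :
  \sum_a lam (cls a) * (m a * w z (srv a)) * (route z a)%:R <=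
  \sum_i lam i * class_min z i - common_level mu u z.
Proof.
have [lv1 _] := dual_values lam_gt0 mu_gt0 rht vu_opt.
set beta := common_level mu u z.
have beta0 : 0 <= beta by apply: common_level_ge0.
have -> : \sum_i lam i * class_min z i =
    \sum_a lam (cls a) * (m a * W z (srv a)) * (route z a)%:R.
  rewrite -sum_cls; apply: eq_bigr => i _; rewrite mulr_sumr.
  by apply: eq_bigr => a /eqP ->; ring.
have -> : beta = \sum_a beta * (lam (cls a) * v (cls a)) * (route z a)%:R.
  by rewrite (sum_routed z (fun i => beta * (lam i * v i))) -mulr_sumr lv1 mulr1.
rewrite -sumrB; apply: ler_sum => a _; rewrite /imbalance -/beta.
have := price_mean_service a; have := d_ge0 a; have := ltW (m_gt0 a).
have := ltW (lam_gt0 (cls a)); case: route => /=; last by rewrite !mulr0; lra.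
move=> l0 m0 d0 um.
have := mulr_ge0 l0 (mulr_ge0 beta0 (mulr_ge0 m0 d0)).
have -> : m a * d a = u (srv a) * m a - v (cls a) by rewrite um; ring.
lra.
Qed.

(** The sums of [w] from arrivals and service cancel up to the factor [r], which leaves the [N1]
    term. Idle servers have nonpositive imbalance and so only help, and [2 * (1 - r) >= 1] leaves
    one full [spread]. *)
Lemma drift_sq_imbalance x z : heavy_traffic_solution lam mu x ->
  G Q z <= rate_bound * sum_sq_service - spread x z + 2 * r * N1 z.
Proof.
move=> xht; have [_ u1] := dual_values lam_gt0 mu_gt0 rht vu_opt.
have m2 a (t : R) : t <= 1 -> m a ^+ 2 * t <= sum_sq_service.
  move=> t1; have := le_sum_sq_service a; have := sqr_ge0 (m a); nra.
have := @birth_death_le Q (fun a => 2 * (m a * w z (srv a)) + sum_sq_service)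
  (fun a => - (2 * (m a * w z (srv a))) + sum_sq_service) z.
have theta a := shift_curvature_bound u_gt0 (srv a).
move=> /(_ _ _)/le_trans; apply.
- move=> a; rewrite (sq_imbalance_shift u_gt0 (workload_add_job mu z a)).
  have /andP[_ /(m2 a)] := theta a; lra.
- move=> a za; rewrite (@sq_imbalance_shift _ _ _ _ mu u u_gt0 z _ (srv a) (- m a)); last first.
    by move=> k; rewrite workload_remove_job// mulNr.
  have /andP[_ /(m2 a)] := theta a; rewrite sqrrN; lra.
have -> : \sum_a (al z a * (2 * (m a * w z (srv a)) + sum_sq_service) +
      be z a * (- (2 * (m a * w z (srv a))) + sum_sq_service)) =
    2 * (\sum_a (al z a * (m a * w z (srv a)) - be z a * (m a * w z (srv a))))
      + total_rate al be z * sum_sq_service.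
  by rewrite /total_rate mulr_sumr mulr_suml -big_split /=; apply: eq_bigr => a _; ring.
rewrite net_flow.
have -> : \sum_a P z a * (mu a * (m a * w z (srv a))) =
    \sum_k w z k - \sum_k w z k * (idle z k)%:R.
  by rewrite -sum_effort; apply: eq_bigr => a _; congr (_ * _); rewrite mulrA mu_m mul1r.
have idle0 : \sum_k w z k * (idle z k)%:R <= 0.
  rewrite -oppr_ge0 -sumrN; apply: sumr_ge0 => k _; rewrite oppr_ge0.
  have [Wk|_] := boolP (idle z k); last by rewrite mulr0.
  by rewrite mulr1; apply: idle_imbalance_le0 => //; apply/eqP.
have := routed_imbalance z; rewrite (weighted_class_min z xht).
have -> : \sum_k W z k = \sum_k w z k + common_level mu u z.
  rewrite -[X in _ + X]mulr1 -u1 mulr_sumr -big_split /=.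
  by apply: eq_bigr => k _; rewrite /imbalance; ring.
have sw : - \sum_k w z k <= N1 z.
  by rewrite -sumrN; apply: ler_sum => k _; rewrite -normrN ler_norm.
have D0 : 0 <= spread x z by apply: spread_ge0; have [] := heavy_traffic_demand xht.
have := ler_wpM2r sum_sq_service_ge0 (total_rate_le z).
set A := \sum_a lam _ * _ * _; set D := spread x z in D0 *.
set Sw := \sum_k w z k in sw *.
set I0 := \sum_k w z k * _ in idle0 *; set C0 := rate_bound * _.
set T := total_rate _ _ _ * _; set n1 := N1 z in sw *.
move=> TC AD.
have : (1 - r) * A <= (1 - r) * (Sw - D) by rewrite ler_wpM2l//; lra.
have : r * - Sw <= r * n1 by rewrite ler_wpM2l// ltW.
have : 0 <= (2^-1 - r) * D by rewrite mulr_ge0// subr_ge0.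
lra.
Qed.


(** Two basic activities of one class under the same allocation have nearly equal ratios [W / u]
    when its spread is small; chains of communicating servers carry this to all pairs. Different
    links may use different allocations, hence the bound over every [x]. The constant does not
    depend on [r]. *)
Lemma imbalance_collapse : exists2 C1 : R, 0 < C1 & forall z (t : R),
  (forall x, heavy_traffic_solution lam mu x -> spread x z <= t) -> N1 z <= C1 * t.
Proof.
pose bounded k l C := 0 <= C /\ forall z (t : R),
  (forall x, heavy_traffic_solution lam mu x -> spread x z <= t) ->
  `|W z k / u k - W z l / u l| <= C * t.
have [x0 x0ht] := rht.
have t_ge0 z (t : R) :
    (forall x, heavy_traffic_solution lam mu x -> spread x z <= t) -> 0 <= t.
  move=> /(_ _ x0ht); apply: le_trans; apply: spread_ge0.
  by have [] := heavy_traffic_demand x0ht.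
(* Zero slack, [mu a * v = u], puts the comparison in terms of a ratio that depends on the class
   alone. *)
have near_min x a z (t : R) : heavy_traffic_solution lam mu x -> 0 < x a ->
    spread x z <= t ->
    0 <= W z (srv a) / u (srv a) - class_min z (cls a) / v (cls a)
      <= (x a * u (srv a))^-1 * t.
  move=> xht xa xt.
  have -> : class_min z (cls a) / v (cls a) = mu a * class_min z (cls a) / u (srv a).
    by rewrite -(basic_price lam_gt0 mu_gt0 rht vu_opt xht xa); field; rewrite !gt_eqF.
  rewrite -mulrBl; apply/andP; split; first by rewrite divr_ge0 ?spread_term_ge0// ltW.
  have -> : (x a * u (srv a))^-1 * t = t / x a / u (srv a).
    by field; rewrite !gt_eqF.
  rewrite ler_pM2r ?invr_gt0// ler_pdivlMr// mulrC; apply: le_trans xt.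
  rewrite /spread (bigD1 a)//= lerDl; apply: sumr_ge0 => b _.
  by rewrite mulr_ge0 ?spread_term_ge0//; have [] := heavy_traffic_demand xht.
have linked k l : communicate lam mu k l -> exists C, bounded k l C.
  elim=> [k1 k2 [x [a [b [ab <- <- [xht xa] [_ xb]]]]]|k1|k1 k2 k3 _ [C [C0 Ct]] _ [C' [C'0 C't]]].
  - exists ((x a * u (srv a))^-1 + (x b * u (srv b))^-1); split.
      by rewrite addr_ge0// invr_ge0 ltW// mulr_gt0.
    move=> z t zt; have := near_min x a z t xht xa (zt _ xht).
    have := near_min x b z t xht xb (zt _ xht); rewrite -ab mulrDl ler_norml.
    by move=> /andP[? ?] /andP[? ?]; apply/andP; split; lra.
  - by exists 0; split => // z t _; rewrite subrr normr0 mul0r.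
  - exists (C + C'); split; first exact: addr_ge0.
    move=> z t zt; rewrite mulrDl (le_trans _ (lerD (Ct z t zt) (C't z t zt)))//.
    by rewrite (le_trans _ (ler_normD _ _))// addrA subrK.
have [C CP] := boolp.choice (fun kl : 'I_nK * 'I_nK => linked kl.1 kl.2 (rcrp.2 _ _)).
pose Cm := \sum_kl C kl.
have C_le kl : C kl <= Cm.
  rewrite /Cm (bigD1 kl)//= lerDl; apply: sumr_ge0 => kl' _.
  by have [] := CP kl'.
have Cm0 : 0 <= Cm by apply: sumr_ge0 => kl _; have [] := CP kl.
exists (Cm + 1) => [|z t zt]; first by lra.
have t0 := t_ge0 z t zt.
have [_ u1] := dual_values lam_gt0 mu_gt0 rht vu_opt.
apply: (@le_trans _ _ (Cm * t)); last by rewrite ler_wpM2r//; lra.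
have -> : Cm * t = \sum_k u k * (Cm * t) by rewrite -mulr_suml u1 mul1r.
apply: ler_sum => k _; have U20 := sq_price_gt0 u_gt0 k.
(* [w k / u k] is the average of the gaps [W k / u k - W l / u l] with weights proportional to
   [u l ^+ 2]. *)
have -> : w z k = u k / (\sum_l u l ^+ 2) *
    \sum_l u l ^+ 2 * (W z k / u k - W z l / u l).
  have -> : \sum_l u l ^+ 2 * (W z k / u k - W z l / u l) =
      (\sum_l u l ^+ 2) * (W z k / u k) - S z.
    rewrite mulr_suml -sumrB; apply: eq_bigr => l _.
    by field; rewrite !gt_eqF.
  by rewrite /imbalance /common_level; field; rewrite !gt_eqF.
have uU0 : 0 <= u k / \sum_l u l ^+ 2 by rewrite divr_ge0// ltW.
rewrite normrM (ger0_norm uU0) -mulrA ler_pM2l// ler_pdivrMl//.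
rewrite [leRHS]mulr_suml; apply: le_trans (ler_norm_sum _ _ _) _.
apply: ler_sum => l _; rewrite normrM ger0_norm ?sqr_ge0// ler_wpM2l ?sqr_ge0//.
by apply: le_trans (ler_wpM2r t0 (C_le (k, l))); have [_] := CP (k, l); exact.
Qed.

Lemma sq_imbalance_add_job z a : Q (add_job z a) - Q z =
  2 * m a * w z (srv a) + m a ^+ 2 * (1 - u (srv a) ^+ 2 / \sum_k u k ^+ 2).
Proof. by rewrite (sq_imbalance_shift u_gt0 (workload_add_job mu z a)) addrC addKr. Qed.

Lemma sq_imbalance_remove_job z a : (0 < z a)%N -> Q (remove_job z a) - Q z =
  - (2 * m a * w z (srv a)) + m a ^+ 2 * (1 - u (srv a) ^+ 2 / \sum_k u k ^+ 2).
Proof.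
move=> za; rewrite (@sq_imbalance_shift _ _ _ _ mu u u_gt0 z _ (srv a) (- m a)).
  by rewrite addrC addKr sqrrN; ring.
by move=> k; rewrite workload_remove_job// mulNr.
Qed.

Lemma sq_jump_bound z a (e : R) : e ^+ 2 = 1 ->
  (e * (2 * m a * w z (srv a)) + m a ^+ 2 * (1 - u (srv a) ^+ 2 / \sum_k u k ^+ 2)) ^+ 2
  <= 8 * sum_sq_service * Q z + 2 * sum_sq_service ^+ 2.
Proof.
move=> e1; have := shift_curvature_bound u_gt0 (srv a).
set th := 1 - _ => /andP[th0 th1].
have mM := le_sum_sq_service a; have m0 := sqr_ge0 (m a).
have wQ := le_sq_imbalance mu u z (srv a); have w0 := sqr_ge0 (w z (srv a)).
have mwQ : m a ^+ 2 * w z (srv a) ^+ 2 <= sum_sq_service * Q z by rewrite ler_pM.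
have mth : m a ^+ 2 * th <= sum_sq_service by nra.
have mth2 : (m a ^+ 2 * th) ^+ 2 <= sum_sq_service ^+ 2.
  by rewrite lerXn2r ?nnegrE ?sum_sq_service_ge0// mulr_ge0.
have := sqr_ge0 (e * (2 * m a * w z (srv a)) - m a ^+ 2 * th).
have -> : (e * (2 * m a * w z (srv a)) - m a ^+ 2 * th) ^+ 2 =
    e ^+ 2 * (4 * (m a ^+ 2 * w z (srv a) ^+ 2)) + (m a ^+ 2 * th) ^+ 2
    - 2 * (e * (2 * m a * w z (srv a)) * (m a ^+ 2 * th)) by ring.
have -> : (e * (2 * m a * w z (srv a)) + m a ^+ 2 * th) ^+ 2 =
    e ^+ 2 * (4 * (m a ^+ 2 * w z (srv a) ^+ 2)) + (m a ^+ 2 * th) ^+ 2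
    + 2 * (e * (2 * m a * w z (srv a)) * (m a ^+ 2 * th)) by ring.
by rewrite e1; lra.
Qed.

Lemma drift_fourth_power z : G (fun z => Q z ^+ 2) z <=
  2 * Q z * G Q z + rate_bound * (8 * sum_sq_service * Q z + 2 * sum_sq_service ^+ 2).
Proof.
set B := 8 * _ * _ + _.
have B0 : 0 <= B.
  by rewrite addr_ge0// !mulr_ge0 ?sum_sq_service_ge0 ?sq_imbalance_ge0 ?sqr_ge0.
have sqD (x y : R) : x ^+ 2 - y ^+ 2 = 2 * y * (x - y) + (x - y) ^+ 2 by ring.
apply: le_trans (@birth_death_le _ (fun a => 2 * Q z * (Q (add_job z a) - Q z) + B)
  (fun a => 2 * Q z * (Q (remove_job z a) - Q z) + B) z _ _) _.
- move=> a; rewrite sqD lerD2l sq_imbalance_add_job.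
  by have := @sq_jump_bound z a 1; rewrite expr1n mul1r; exact.
- move=> a za; rewrite sqD lerD2l sq_imbalance_remove_job//.
  by have := @sq_jump_bound z a (-1); rewrite sqrrN expr1n mulN1r; exact.
apply: le_trans (lerD (lexx _) (ler_wpM2r B0 (total_rate_le z))).
rewrite /birth_death /total_rate mulr_sumr mulr_suml -big_split /=.
by apply: ler_sum => a _; rewrite le_eqVlt; apply/orP; left; apply/eqP; ring.
Qed.

(** * Stationary moment bounds *)

(** [K1 * C1] is the size of [N1] beyond which the drift of [Q] outweighs the second-order terms. No
    constant here involves [r]. *)
Definition imbalance_bound (C1 : R) : R :=
  let K1 := 2 * (rate_bound * sum_sq_service) + 8 * (rate_bound * sum_sq_service) + 1 in
  K1 * (K1 * C1) ^+ 2 + 2 * (rate_bound * sum_sq_service ^+ 2).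

Variable nu : probability (state J) R.
Hypothesis nu_sub : subinvariant al be nu.

Let foster_nu := foster arrival_rate_ge0 service_rate_ge0 nu_sub total_rate_le.

(** The drift of [S] is the loss rate minus [r], the wrong sign for Foster's criterion. The
    reciprocal test functions decrease in [S], so their drift is at most [r] minus the loss rate
    damped by [A n z ^+ 2], with an error of order [h n]; Fatou's lemma finishes. *)
Lemma mean_loss_rate : mean_le nu loss_rate r.
Proof.
pose h (n : nat) : R := n.+1%:R^-1.
have h0 n : 0 < h n by rewrite invr_gt0.
pose A n z := (1 + h n * S z)^-1.
have S0 z : 0 <= S z by apply: weighted_workload_ge0.
have A01 n z : 0 <= A n z <= 1.
  have A1 : 1 <= 1 + h n * S z by rewrite lerDl mulr_ge0// ltW.
  by rewrite invr_ge0 invf_le1 (lt_le_trans ltr01 A1, le_trans ler01 A1).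
have A2 n z : A n z ^+ 2 <= 1 by have /andP[? ?] := A01 n z; rewrite exprn_ile1.
pose c a := u (srv a) * m a.
pose M := \sum_a c a ^+ 2.
have cM a : c a ^+ 2 <= M.
  by rewrite /M (bigD1 a)//= lerDl; apply: sumr_ge0 => *; exact: sqr_ge0.
have M0 : 0 <= M by apply: sumr_ge0 => *; exact: sqr_ge0.
pose C := rate_bound * M.
have C0 : 0 <= C by rewrite mulr_ge0 ?rate_bound_ge0.
have drift n z : G (fun z => (h n)^-1 * A n z) z <= (r + C * h n) - A n z ^+ 2 * loss_rate z.
  have hM a : h n * c a ^+ 2 <= h n * M by rewrite ler_pM2l.
  apply: le_trans (@birth_death_le _ (fun a => - (A n z ^+ 2 * c a) + h n * M)
    (fun a => A n z ^+ 2 * c a + h n * M) z _ _) _.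
  - move=> a; have Sz' := weighted_workload_add_job mu u z a.
    apply: le_trans (lerD (lexx _) (hM a)).
    by rewrite /A Sz'; apply: reciprocal_drop => //; rewrite -Sz'.
  - move=> a za; have Sz' := weighted_workload_remove_job mu u za.
    apply: le_trans (lerD (lexx _) (hM a)).
    have := @reciprocal_drop R (h n) (S z) (- c a) (h0 n) (S0 z).
    by rewrite sqrrN mulrN opprK /A Sz'; apply; rewrite -Sz'.
  have -> : \sum_a (al z a * (- (A n z ^+ 2 * c a) + h n * M) +
        be z a * (A n z ^+ 2 * c a + h n * M)) =
      - (A n z ^+ 2) * (\sum_a (al z a * c a - be z a * c a))
      + h n * M * total_rate al be z.
    rewrite /total_rate !mulr_sumr -big_split /=.
    by apply: eq_bigr => a _; ring.
  rewrite net_flow_price.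
  have := ler_wpM2l (mulr_ge0 (ltW (h0 n)) M0) (total_rate_le z).
  have -> : h n * M * rate_bound = C * h n by rewrite /C; ring.
  have := ler_wpM2r (ltW r_gt0) (A2 n z); rewrite mul1r; lra.
apply: (@mean_le_fatou _ _ _ _ _ (fun n z => A n z ^+ 2 * loss_rate z) _
  (fun n => r + C * h n)).
- by move=> n z; rewrite mulr_ge0 ?sqr_ge0 ?loss_rate_ge0.
- move=> z; rewrite -[loss_rate z in X in (_ --> X)%classic]mul1r.
  apply: cvgMl; have Ac : (A n z @[n --> \oo] --> (1 : R))%classic.
    have -> : 1 = (1 + 0 * S z)^-1 :> R by rewrite mul0r addr0 invr1.
    apply: cvgV; first by rewrite mul0r addr0 oner_neq0.
    by apply: cvgD; [exact: cvg_cst | apply: cvgMl; exact: cvg_harmonic].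
  by have := cvgM Ac Ac; rewrite mulr1; apply.
- have Ch : (C * h n @[n --> \oo] --> C * 0)%classic by apply: cvgMr; exact: cvg_harmonic.
  have rc : ((fun=> r) n @[n --> \oo] --> r)%classic by exact: cvg_cst.
  by have := cvgD rc Ch; rewrite mulr0 addr0; apply.
- move=> n; have b0 := addr_ge0 (ltW r_gt0) (mulr_ge0 C0 (ltW (h0 n))).
  apply: (@foster_nu (fun z => (h n)^-1 * A n z) (fun=> r + C * h n)) => //.
  + by move=> z; have /andP[? _] := A01 n z; rewrite mulr_ge0// invr_ge0 ltW.
  + by move=> z; rewrite mulr_ge0 ?sqr_ge0 ?loss_rate_ge0.
  + exact: mean_le_cst.
Qed.

Variable C1 : R.
Hypothesis C1_gt0 : 0 < C1.
Hypothesis collapse : forall z (t : R),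
  (forall x, heavy_traffic_solution lam mu x -> spread x z <= t) -> N1 z <= C1 * t.
Hypothesis r_small : 4 * r * C1 <= 1.

(** The drift of [Q] does not depend on [x], so it bounds all spreads at once by the same [t] and
    collapse applies. Smallness of [r] absorbs the term [2 * r * N1 z]. *)
Lemma drift_sq_imbalance_collapsed z :
  2 * C1 * G Q z <= 2 * C1 * (rate_bound * sum_sq_service) - N1 z.
Proof.
have N0 := abs_imbalance_ge0 mu u z.
have : 4 * r * C1 * N1 z <= 1 * N1 z by rewrite ler_wpM2r.
pose t := rate_bound * sum_sq_service + 2 * r * N1 z - G Q z.
have /collapse : forall x, heavy_traffic_solution lam mu x -> spread x z <= t.
  by move=> x xht; have := drift_sq_imbalance z xht; rewrite /t; lra.
by rewrite /t; lra.
Qed.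

(** The test function [Q^2] gains a factor [Q] over [Q] itself. For [N1] above [K1 * C1] its drift
    is at most [- Q] plus a constant; below, [Q] is bounded and the drift of [Q] is at most [c0]. *)
Lemma mean_sq_imbalance : mean_le nu Q (imbalance_bound C1).
Proof.
have M0 := sum_sq_service_ge0; have L0 := rate_bound_ge0.
set K := imbalance_bound C1.
have K0 : 0 <= K.
  have LM := mulr_ge0 L0 M0.
  rewrite addr_ge0// mulr_ge0// ?sqr_ge0// ?mulr_ge0 ?sqr_ge0//; lra.
apply: (@foster_nu (fun z => Q z ^+ 2) (fun=> K)) => //.
- by move=> z; exact: sqr_ge0.
- by move=> z; exact: sq_imbalance_ge0.
- move=> z; apply: le_trans (drift_fourth_power z) _.
  have := drift_sq_imbalance_collapsed z.
  have Q0 := sq_imbalance_ge0 mu u z; have N0 := abs_imbalance_ge0 mu u z.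
  have QN := sq_imbalance_le mu u z; have C10 := C1_gt0.
  rewrite /K /imbalance_bound /=.
  set c0 := rate_bound * sum_sq_service.
  have -> : rate_bound * (8 * sum_sq_service * Q z + 2 * sum_sq_service ^+ 2) =
    8 * c0 * Q z + 2 * (rate_bound * sum_sq_service ^+ 2) by rewrite /c0; ring.
  have c00 : 0 <= c0 by rewrite mulr_ge0.
  set K1 := 2 * c0 + 8 * c0 + 1; set q := Q z in Q0 QN *; set n1 := N1 z in N0 QN *.
  move=> dQ.
  suff : 2 * q * G Q z + 8 * c0 * q <= K1 * (K1 * C1) ^+ 2 - q by lra.
  have K10 : 0 <= K1 by rewrite /K1; lra.
  have [nsmall|nlarge] := leP n1 (K1 * C1).
    have qK : q <= (K1 * C1) ^+ 2.
      by apply: le_trans QN _; rewrite lerXn2r ?nnegrE// mulr_ge0// ltW.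
    have gc : G Q z <= c0 by rewrite -(ler_pM2l C10); lra.
    have := ler_wpM2l Q0 gc; have := ler_wpM2l K10 qK; rewrite /K1; lra.
  have gK : 2 * G Q z + 8 * c0 + 1 <= 0.
    by rewrite -(pmulr_rle0 _ C10); rewrite /K1 in nlarge; lra.
  have := ler_wpM2l Q0 gK; rewrite mulr0.
  have : 0 <= K1 * (K1 * C1) ^+ 2 by rewrite mulr_ge0 ?sqr_ge0.
  lra.
- exact: mean_le_cst.
Qed.

(** * Workload level when value is lost, and the slack activities *)

Let total_service := \sum_a m a.

Let le_total_service a : m a <= total_service.
Proof. by rewrite /total_service (bigD1 a)//= lerDl; apply: sumr_ge0 => b _; exact: ltW. Qed.

Lemma weighted_workload_level z (k : 'I_nK) : S z = common_level mu u z * \sum_l u l ^+ 2.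
Proof. by rewrite /common_level mulfVK// gt_eqF// (sq_price_gt0 u_gt0 k). Qed.

(* Compare [a] with an activity [b] of the same class and zero slack: the routing
   rule gives [m_a W_k <= m_b W_l], and the common level contributes
   [m_a d_a] more to the left side than to the right side. *)
Lemma routed_level z a : route z a -> 0 < d a ->
  S z <= 2 * (\sum_k u k ^+ 2) * total_service / (m a * d a) * N1 z.
Proof.
move=> aroute da; have [x xht] := rht.
have [b ba xb] := demand_served lam_gt0 (cls a) (heavy_traffic_demand xht).
have := wwta_route_min aroute ba.
have db := complementary_slackness lam_gt0 mu_gt0 rht vu_opt xht xb.
have := price_mean_service b; rewrite db mulr0 addr0 ba.
have WE k : W z k = w z k + common_level mu u z * u k by rewrite /imbalance subrK.
rewrite !WE (weighted_workload_level z (srv a)).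
have := price_mean_service a.
set beta := common_level mu u z; set U2 := \sum_k _ => ua ub aleb.
have U20 : 0 < U2 by exact: sq_price_gt0 u_gt0 (srv a).
have md0 : 0 < m a * d a by rewrite mulr_gt0.
have bmd : beta * (m a * d a) <= m b * w z (srv b) - m a * w z (srv a).
  have -> : beta * (m a * d a) = beta * (u (srv a) * m a) - beta * (u (srv b) * m b).
    by rewrite ua ub; ring.
  move: aleb; rewrite !mulrDr; lra.
have mw c : m c * `|w z (srv c)| <= total_service * N1 z.
  by rewrite ler_pM ?normr_ge0 ?le_total_service ?le_abs_imbalance// ltW.
have : beta * (m a * d a) <= 2 * (total_service * N1 z).
  apply: le_trans bmd _; have := mw a; have := mw b.
  have := ler_wpM2l (ltW (m_gt0 b)) (ler_norm (w z (srv b))).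
  have := ler_wpM2l (ltW (m_gt0 a)) (ler_norm (- w z (srv a))).
  by rewrite normrN mulrN; lra.
rewrite -ler_pdivlMr// => betale.
have := ler_wpM2r (ltW U20) betale; congr (_ <= _); field.
by rewrite !gt_eqF.
Qed.

Lemma idle_level z k : idle z k -> S z <= (\sum_l u l ^+ 2) / u k * N1 z.
Proof.
move=> /eqP Wk; rewrite (weighted_workload_level z k) mulrC -mulrA.
rewrite ler_wpM2l//; first by rewrite ltW// (sq_price_gt0 u_gt0 k).
rewrite mulrC ler_pdivlMr//.
have -> : common_level mu u z * u k = - w z k by rewrite /imbalance Wk; ring.
by apply: le_trans (ler_norm _) _; rewrite normrN le_abs_imbalance.
Qed.

(** It dominates the factors of [routed_level] and [idle_level] together. Activities of zero slack
    contribute 0, the value of division by 0. *)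
Definition level_factor : R :=
  \sum_a 2 * (\sum_k u k ^+ 2) * total_service / (m a * d a) +
  \sum_k (\sum_l u l ^+ 2) / u k.

Let route_factor_ge0 a :
  0 <= 2 * (\sum_k u k ^+ 2) * total_service / (m a * d a).
Proof.
rewrite divr_ge0 ?mulr_ge0//; last exact: ltW.
  by apply: sumr_ge0 => *; exact: sqr_ge0.
by apply: sumr_ge0 => b _; exact: ltW.
Qed.

Let idle_factor_ge0 k : 0 <= (\sum_l u l ^+ 2) / u k.
Proof. by rewrite divr_ge0 ?ltW// (sq_price_gt0 u_gt0 k). Qed.

Lemma level_factor_ge0 : 0 <= level_factor.
Proof. by rewrite addr_ge0//; apply: sumr_ge0. Qed.

Lemma level_loss z :
  S z * (waste z + idleness z) <= level_factor * N1 z * (waste z + idleness z).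
Proof.
have N0 := abs_imbalance_ge0 mu u z.
set X := level_factor * N1 z.
rewrite !mulrDr; apply: lerD.
  rewrite /waste !mulr_sumr; apply: ler_sum => a _.
  have c0 : 0 <= lam (cls a) * (m a * d a) by rewrite !mulr_ge0// ltW.
  have [aroute|_] := boolP (route z a); last by rewrite !mulr0.
  have := d_ge0 a; rewrite le_eqVlt => /orP[/eqP <-|da]; first by rewrite !(mulr0, mul0r).
  apply: ler_wpM2r; first by rewrite mulr_ge0.
  apply: le_trans (routed_level aroute da) _.
  rewrite /X ler_wpM2r// /level_factor (bigD1 a)//= -addrA lerDl addr_ge0//; exact: sumr_ge0.
rewrite /idleness !mulr_sumr; apply: ler_sum => k _.
have [kidle|_] := boolP (idle z k); last by rewrite !mulr0.
apply: ler_wpM2r; first by rewrite mulr_ge0// ltW.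
apply: le_trans (idle_level kidle) _.
rewrite /X ler_wpM2r// /level_factor [Y in _ + Y](bigD1 k)//= addrCA lerDl.
by rewrite addr_ge0//; exact: sumr_ge0.
Qed.

Definition price_loss_bound : R :=
  level_factor / 2 * ((waste_bound + 1) * imbalance_bound C1 + 2 * nK%:R).

(* Young's inequality with weight [s = sqrt r] balances the bounded second moment
   of the imbalance against the loss rate, whose mean is at most [r]. *)
Lemma mean_price_loss (s : R) : 0 < s -> s ^+ 2 = r ->
  mean_le nu (fun z => S z * (waste z + idleness z)) (price_loss_bound * s).
Proof.
move=> s0 sr; have f0 := level_factor_ge0.
have wb0 : 0 <= waste_bound by apply: sumr_ge0 => a _; rewrite !mulr_ge0// ltW.
pose c1 := level_factor / 2 * (s * (waste_bound + 1)).
pose c2 := level_factor / 2 * (nK%:R * 2 / s).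
have c10 : 0 <= c1 by rewrite mulr_ge0 ?divr_ge0// mulr_ge0 ?addr_ge0// ltW.
have c20 : 0 <= c2 by rewrite mulr_ge0 ?divr_ge0// ?mulr_ge0// ltW.
have -> : price_loss_bound * s = c1 * imbalance_bound C1 + c2 * r.
  by rewrite /price_loss_bound /c1 /c2 -sr; field; rewrite gt_eqF.
have Q0 := sq_imbalance_ge0 mu u.
have : mean_le nu (fun z => c1 * Q z + c2 * loss_rate z) (c1 * imbalance_bound C1 + c2 * r).
  apply: mean_leD (mean_leZ c10 Q0 mean_sq_imbalance)
    (mean_leZ c20 loss_rate_ge0 mean_loss_rate) => z; rewrite mulr_ge0//.
  exact: loss_rate_ge0.
apply: mean_le_mono => z.
  by rewrite mulr_ge0 ?addr_ge0 ?waste_ge0 ?idleness_ge0// weighted_workload_ge0.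
apply: le_trans (level_loss z) _.
set t := waste z + idleness z.
have t0 : 0 <= t by rewrite addr_ge0 ?waste_ge0 ?idleness_ge0.
(* After Young's inequality the [t] beside [Q] is replaced by this constant, and the other [t] by
   twice the loss rate. *)
have tb : t <= waste_bound + 1 by rewrite lerD ?waste_le ?idleness_le1.
have tl : t <= 2 * loss_rate z.
  rewrite /t /loss_rate; have := waste_ge0 z; have := idleness_ge0 z.
  have := r_le; nra.
have young (y : R) : `|y| * t <= (s * y ^+ 2 * t + t / s) / 2.
  have := mulr_ge0 (divr_ge0 t0 (ltW s0)) (sqr_ge0 (s * `|y| - 1)).
  have -> : t / s * (s * `|y| - 1) ^+ 2 = s * `|y| ^+ 2 * t + t / s - 2 * (`|y| * t).
    by field; rewrite gt_eqF.
  by rewrite real_normK ?num_real//; lra.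
have Nt : N1 z * t <= (s * Q z * t + nK%:R * (t / s)) / 2.
  rewrite /abs_imbalance mulr_suml.
  apply: le_trans (ler_sum _ (fun k _ => young (w z k))) _.
  rewrite -mulr_suml big_split /= sumr_const card_ord -[_ *+ nK]mulr_natl.
  by rewrite /sq_imbalance mulr_sumr mulr_suml.
rewrite -mulrA; apply: le_trans (ler_wpM2l f0 Nt) _.
have -> : c1 * Q z + c2 * loss_rate z = level_factor *
    ((s * Q z * (waste_bound + 1) + nK%:R * (2 * loss_rate z / s)) / 2).
  by rewrite /c1 /c2; field; rewrite gt_eqF.
rewrite ler_wpM2l// ler_pM2r ?invr_gt0//; apply: lerD.
  by rewrite ler_wpM2l// mulr_ge0// ltW.
by rewrite ler_wpM2l// ler_pM2r// invr_gt0.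
Qed.

Lemma waste_term_le z a :
  lam (cls a) * (m a * d a) * (route z a)%:R <= waste z + idleness z.
Proof.
rewrite -[leLHS]addr0 lerD ?idleness_ge0// /waste (bigD1 a)//= lerDl.
by apply: sumr_ge0 => b _; rewrite !mulr_ge0// ltW.
Qed.

Definition route_bound a : R := price_loss_bound / (lam (cls a) * (m a * d a)).

Lemma mean_routed_workload (s : R) a : 0 < s -> s ^+ 2 = r -> 0 < d a ->
  mean_le nu (fun z => S z * (route z a)%:R) (route_bound a * s).
Proof.
move=> s0 sr da.
have k0 : 0 < lam (cls a) * (m a * d a) by rewrite !mulr_gt0.
have S0 z : 0 <= S z by apply: weighted_workload_ge0.
have St0 z : 0 <= S z * (waste z + idleness z).
  by rewrite mulr_ge0 ?addr_ge0 ?waste_ge0 ?idleness_ge0.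
have := mean_leZ (ltW (eqbRL (invr_gt0 _) k0)) St0 (mean_price_loss s0 sr).
have -> : (lam (cls a) * (m a * d a))^-1 * (price_loss_bound * s) = route_bound a * s.
  by rewrite /route_bound; ring.
apply: mean_le_mono => z; first by rewrite mulr_ge0.
rewrite ler_pdivlMl// mulrCA ler_wpM2l//; exact: waste_term_le.
Qed.

Let rate_mean_bound a : R := 2 / (m a * d a).

Lemma mean_arrival_rate a : 0 < d a ->
  mean_le nu (fun z => al z a) (rate_mean_bound a * r).
Proof.
move=> da; have md0 : 0 < m a * d a by rewrite mulr_gt0.
have c0 : 0 <= rate_mean_bound a by rewrite divr_ge0// ltW.
apply: mean_le_mono (mean_leZ c0 loss_rate_ge0 mean_loss_rate) => z.
  exact: arrival_rate_ge0.
rewrite /rate_mean_bound mulrAC ler_pdivlMr//.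
have := waste_term_le z a; rewrite /loss_rate /arrival_rate.
have := waste_ge0 z; have := idleness_ge0 z; have := ltW (lam_gt0 (cls a)).
move: (ltW md0) r_le r_gt0; move: (lam _) (waste z) (idleness z) (m a * d a).
by case: route => /= l W0 I0 md md1 r1 r2 l0 i0 w0 le1; nra.
Qed.

(** The test function [z a] has drift [al z a - be z a], so departures are on average no more
    frequent than arrivals. *)
Lemma mean_service_rate a : 0 < d a ->
  mean_le nu (fun z => be z a) (rate_mean_bound a * r).
Proof.
move=> da; apply: (foster_nu (f := fun z => (z a)%:R) _ _ _ _ (mean_arrival_rate da)) => z.
- exact: ler0n.
- exact: arrival_rate_ge0.
- exact: service_rate_ge0.
rewrite (@birth_death_eq _ (fun b => (a == b)%:R) (fun b => - (a == b)%:R)).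
- rewrite (bigD1 a)//= eqxx big1 => [|b]; first by rewrite mulr1 mulrN1 addr0.
  by rewrite eq_sym => /negPf ->; rewrite oppr0 !mulr0 addr0.
- by move=> b; rewrite ffunE natrD; ring.
- move=> b zb; rewrite ffunE; case: eqVneq => [->|_]; last by rewrite subn0 subrr oppr0.
  by rewrite natrB//; ring.
Qed.

Definition slack_activity_bound a : R :=
  mu a / u (srv a) * price_loss_bound + lam (cls a) * route_bound a +
  u (srv a) * m a * (2 * rate_mean_bound a).

(** In the drift of [z a * S z], the flow of value contributes [- r * z a] and departures from [a]
    contribute [- mu a * P z a * S z]. What remains is [z a] times the loss rate, with [z a] at most
    [mu a / u (srv a) * S z], the routed workload, and a multiple of the jump rates of [a]. *)
Lemma mean_slack_activity (s : R) a : 0 < s -> s ^+ 2 = r -> 0 < d a ->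
  mean_le nu (fun z => r * (z a)%:R + mu a * (P z a * S z)) (slack_activity_bound a * s).
Proof.
move=> s0 sr da; have S0 z : 0 <= S z by apply: weighted_workload_ge0.
have um0 b : 0 < u (srv b) * m b by rewrite mulr_gt0.
have s1 : s <= 1 by have := r_le; rewrite -sr; nra.
have loss0 z : 0 <= waste z + idleness z by rewrite addr_ge0 ?waste_ge0 ?idleness_ge0.
have rb0 : 0 <= rate_mean_bound a by rewrite divr_ge0// mulr_ge0// ltW.
pose b z := mu a / u (srv a) * (S z * (waste z + idleness z)) +
  lam (cls a) * (S z * (route z a)%:R) + u (srv a) * m a * (al z a + be z a).
have c10 : 0 <= mu a / u (srv a) by rewrite divr_ge0// ltW.
have b1 z : 0 <= S z * (waste z + idleness z) by rewrite mulr_ge0.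
have b2 z : 0 <= S z * (route z a)%:R by rewrite mulr_ge0.
have b3 z : 0 <= al z a + be z a by rewrite addr_ge0 ?arrival_rate_ge0 ?service_rate_ge0.
have l0 := ltW (lam_gt0 (cls a)).
have P0 z : 0 <= P z a by have [P01 _ _] := P_policy; have /andP[] := P01 z a.
have mean_b : mean_le nu b (slack_activity_bound a * s).
  apply: (@mean_le_weaken _ _ _ _ _ _ (mu a / u (srv a) * (price_loss_bound * s) +
    lam (cls a) * (route_bound a * s) +
    u (srv a) * m a * (rate_mean_bound a * r + rate_mean_bound a * r))).
    have -> : slack_activity_bound a * s = mu a / u (srv a) * (price_loss_bound * s) +
        lam (cls a) * (route_bound a * s) +
        u (srv a) * m a * (rate_mean_bound a * s + rate_mean_bound a * s).
      by rewrite /slack_activity_bound; ring.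
    rewrite lerD2l ler_pM2l//.
    by have : rate_mean_bound a * r <= rate_mean_bound a * s;
      [rewrite ler_wpM2l// -sr; nra | lra].
  apply: mean_leD.
  - by move=> z; rewrite addr_ge0// mulr_ge0.
  - by move=> z; rewrite mulr_ge0// ltW.
  - apply: mean_leD.
    + by move=> z; rewrite mulr_ge0.
    + by move=> z; rewrite mulr_ge0.
    + by apply: mean_leZ => //; exact: mean_price_loss.
    + by apply: mean_leZ => //; exact: mean_routed_workload.
  - apply: mean_leZ => //; first exact: ltW.
    apply: (mean_leD (fun z => arrival_rate_ge0 z a) (fun z => service_rate_ge0 z a)).
      exact: mean_arrival_rate.
    exact: mean_service_rate.
apply: (foster_nu (f := fun z => (z a)%:R * S z) _ _ _ _ mean_b) => z.
- by rewrite mulr_ge0.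
- by rewrite addr_ge0 ?addr_ge0//; [exact: mulr_ge0 ..| rewrite mulr_ge0// ltW].
- by apply: addr_ge0; apply: mulr_ge0 => //; [exact: ltW..| rewrite mulr_ge0].
rewrite (@birth_death_eq _
  (fun c => (z a)%:R * (u (srv c) * m c) + (a == c)%:R * (S z + u (srv a) * m a))
  (fun c => - ((z a)%:R * (u (srv c) * m c)) - (a == c)%:R * (S z - u (srv a) * m a))).
- have -> : \sum_c (al z c *
        ((z a)%:R * (u (srv c) * m c) + (a == c)%:R * (S z + u (srv a) * m a)) +
      be z c * (- ((z a)%:R * (u (srv c) * m c)) - (a == c)%:R * (S z - u (srv a) * m a))) =
    (z a)%:R * (\sum_c (al z c * (u (srv c) * m c) - be z c * (u (srv c) * m c))) +
    (al z a * (S z + u (srv a) * m a) - be z a * (S z - u (srv a) * m a)).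
    rewrite mulr_sumr [RHS]addrC.
    have -> : al z a * (S z + u (srv a) * m a) - be z a * (S z - u (srv a) * m a) =
        \sum_c (a == c)%:R * (al z c * (S z + u (srv a) * m a) - be z c * (S z - u (srv a) * m a)).
      rewrite (bigD1 a)//= eqxx mul1r big1 ?addr0// => c.
      by rewrite eq_sym => /negPf ->; rewrite mul0r.
    by rewrite -big_split /=; apply: eq_bigr => c _; ring.
  rewrite net_flow_price /b /service_rate.
  have zS : (z a)%:R * loss_rate z <= mu a / u (srv a) * (S z * (waste z + idleness z)).
    rewrite mulrA; apply: ler_pM; rewrite ?loss_rate_ge0//.
      have := le_weighted_workload mu_gt0 u_gt0 z a.
      rewrite -ler_pdivlMl// => /le_trans; apply.
      by rewrite le_eqVlt /mean_service invfM invrK [mu a / _]mulrC eqxx.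
    have := waste_ge0 z; have := r_gt0; rewrite /loss_rate; nra.
  have alS : al z a * S z <= lam (cls a) * (S z * (route z a)%:R).
    have := mulr_ge0 (mulr_ge0 (ltW r_gt0) l0) (b2 z); rewrite /arrival_rate; lra.
  lra.
- move=> c; rewrite weighted_workload_add_job ffunE natrD.
  by case: eqVneq => [->|_] /=; ring.
- move=> c zc; rewrite weighted_workload_remove_job// ffunE.
  case: eqVneq => [->|_] /=; last by rewrite subn0; ring.
  by rewrite natrB//; ring.
Qed.

End Drift.

(** * From mean bounds to asymptotics of expectations *)

Section Expectations.
Variables (R : realType) (nI nK : nat) (J : {set 'I_nI * 'I_nK}).

Lemma bigO_sqrt (f : R -> \bar R) (r0 C : R) : 0 < r0 ->
  (forall r : R, 0 < r < r0 -> (0 <= f r <= (C * Num.sqrt r)%:E)%E) ->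
  bigO_at0 f (fun r => r `^ (1 / 2)).
Proof.
move=> r00 fC; rewrite /bigO_at0 limf_esupE.
apply: (@le_lt_trans _ _ C%:E); last by rewrite ltry.
pose V := [set r : R | 0 < r < r0]%classic.
apply: (@le_trans _ _ (ereal_sup
    ((fun r => `|f r * ((r `^ (1 / 2))^-1)%:E|%E) @` V)))%classic.
  apply: ereal_inf_lbound; exists V => //.
  rewrite /V; near=> r; rewrite /=; apply/andP; split; near: r.
    exact: nbhs_right_gt.
  exact: nbhs_right_lt.
apply: ge_ereal_sup => _ [r rV <-].
have /andP[f0 fle] := fC r rV; have /andP[r_gt0 _] := rV.
have s0 : 0 < Num.sqrt r by rewrite sqrtr_gt0.
have -> : r `^ (1 / 2) = Num.sqrt r by rewrite mul1r powR12_sqrt// ltW.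
rewrite gee0_abs; last by rewrite mule_ge0// lee_fin invr_ge0 ltW.
by rewrite lee_pdivrMr.
Unshelve. all: by end_near. Qed.

Lemma expectation_mean_le (d : measure_display) (Omega : measurableType d)
    (Pr : probability Omega R) (Z : {RV Pr >-> state J}) (f : state J -> R) c :
  (forall z, 0 <= f z) -> mean_le (distribution Pr Z) f c ->
  (0 <= 'E_Pr[fun w => f (Z w)] <= c%:E)%E.
Proof.
move=> f0 fc; rewrite unlock; apply/andP; split.
  by apply: integral_ge0 => w _; rewrite lee_fin.
apply: le_trans fc; rewrite ge0_integral_pushforward// => z _.
by rewrite lee_fin.
Qed.

End Expectations.

Theorem lemma7p2 (R : realType) (nI nK : nat) (J : {set 'I_nI * 'I_nK})
  (lam : 'I_nI -> R) (mu : activity J -> R)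
  (lam_gt0 : forall i, 0 < lam i) (mu_gt0 : forall a, 0 < mu a)
  (rht : relaxed_heavy_traffic lam mu)
  (rcrp : relaxed_complete_resource_pooling lam mu)
  (v : 'I_nI -> R) (u : 'I_nK -> R) (vu_opt : dual_optimal lam mu v u)
  (P : state J -> activity J -> R) (P_policy : non_idling_policy P)
  (p : R -> R -> R.-pker (state J) ~> (state J))
  (p_ctmc : forall r : R, 0 < r < 1 ->
    ctmc_transition_function (generator lam mu P r) (p r))
  (d : R -> measure_display) (Omega : forall r, measurableType (d r))
  (Pr : forall r, probability (Omega r) R)
  (Z : forall r, {RV (Pr r) >-> state J})
  (Z_stationary : forall r : R, 0 < r < 1 ->
    stationary (p r) (distribution (Pr r) (Z r))) :
  (forall a : activity J, non_basic lam mu a -> 0 < dual_slack mu v u a ->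
    bigO_at0 (fun r : R => 'E_(Pr r)[fun w =>
        (weighted_workload mu u (Z r w) * (wwta_route mu (Z r w) a)%:R)%R])%E
      (fun r : R => r `^ (1 / 2))
    /\
    bigO_at0 (fun r : R => 'E_(Pr r)[fun w =>
        (P (Z r w) a * weighted_workload mu u (Z r w))%R])%E
      (fun r : R => r `^ (1 / 2)))
  /\
  bigO_at0 (fun r : R => r%:E * 'E_(Pr r)[fun w =>
      (\sum_i \sum_(a : activity J | (cls a == i) && (0 < dual_slack mu v u a))
         v i * (Z r w a)%:R)%R])%E
    (fun r : R => r `^ (1 / 2)).
Proof.
have [C1 C1_gt0 collapse] := imbalance_collapse lam_gt0 mu_gt0 rht rcrp vu_opt.
(* The two terms yield [r <= 2^-1] and [4 * r * C1 <= 1]; below [r0] every constant is independent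
   of [r]. *)
pose r0 := Num.min 2^-1 (4 * C1)^-1.
have r0_gt0 : 0 < r0 by rewrite lt_min !invr_gt0 ltr0n mulr_gt0.
have balance r : 0 < r < r0 -> [/\ 0 < r, r <= 2^-1, 4 * r * C1 <= 1,
    0 < Num.sqrt r /\ Num.sqrt r ^+ 2 = r &
    subinvariant (arrival_rate lam mu r) (service_rate mu P)
      (distribution (Pr r) (Z r))].
  rewrite /r0 lt_min => /andP[r_gt0 /andP[r_lt rC]].
  have r_le := ltW r_lt; have r01 : 0 < r < 1 by lra.
  split=> //.
  - rewrite mulrAC -ler_pdivlMl ?mulr_gt0// mulr1; exact: ltW.
  - by rewrite sqrtr_gt0 sqr_sqrtr// ltW.
  - apply: (stationary_subinvariant _ _ (generatorE lam mu P r) (p_ctmc r r01)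
      (Z_stationary r r01)).
      by move=> z a; exact: arrival_rate_ge0.
    by move=> z a; exact: service_rate_ge0.
have u_gt0 := server_price_gt0 lam_gt0 mu_gt0 rht vu_opt rcrp.
have v_gt0 := class_value_gt0 lam_gt0 mu_gt0 rht vu_opt rcrp.
have S0 z : 0 <= weighted_workload mu u z by apply: weighted_workload_ge0.
have [P01 _ _] := P_policy.
have P0 z a : 0 <= P z a by have /andP[] := P01 z a.
pose K a := slack_activity_bound lam mu v u C1 a.
split=> [a _ da|].
  split.
    apply: (bigO_sqrt (C := route_bound lam mu v u C1 a) r0_gt0) => r rr0.
    have [r_gt0 r_le r_small [s0 sr] sub] := balance r rr0.
    apply: (expectation_mean_le
      (f := fun z => weighted_workload mu u z * (wwta_route mu z a)%:R)).
      by move=> z; rewrite mulr_ge0.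
    exact: (mean_routed_workload lam_gt0 mu_gt0 rht rcrp vu_opt P_policy r_gt0
      r_le sub C1_gt0 collapse r_small s0 sr da).
  apply: (bigO_sqrt (C := (mu a)^-1 * K a) r0_gt0) => r rr0.
  have [r_gt0 r_le r_small [s0 sr] sub] := balance r rr0.
  apply: (expectation_mean_le (f := fun z => P z a * weighted_workload mu u z)).
    by move=> z; rewrite mulr_ge0.
  have sum0 (z : state J) : 0 <= r * (z a)%:R + mu a * (P z a * weighted_workload mu u z).
    by rewrite addr_ge0// mulr_ge0 ?mulr_ge0// ltW.
  have mua : 0 <= (mu a)^-1 by rewrite invr_ge0 ltW.
  have := mean_leZ mua sum0 (mean_slack_activity lam_gt0 mu_gt0 rht rcrp vu_opt
    P_policy r_gt0 r_le sub C1_gt0 collapse r_small s0 sr da).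
  rewrite mulrA; apply: mean_le_mono => z; first by rewrite mulr_ge0.
  by rewrite ler_pdivlMl// lerDr mulr_ge0// ltW.
pose c a := if 0 < dual_slack mu v u a then v (cls a) * K a else 0.
apply: (bigO_sqrt (C := \sum_a c a) r0_gt0) => r rr0.
have [r_gt0 r_le r_small [s0 sr] sub] := balance r rr0.
pose f (z : state J) := \sum_i \sum_(a : activity J |
  (cls a == i) && (0 < dual_slack mu v u a)) v i * (z a)%:R.
pose g a (z : state J) :=
  if 0 < dual_slack mu v u a then v (cls a) * (z a)%:R else 0.
have fE z : f z = \sum_a g a z.
  rewrite -sum_cls; apply: eq_bigr => i _; rewrite big_mkcondr /=.
  by apply: eq_bigr => a /eqP ai; rewrite /g ai.
have g0 a z : 0 <= g a z by rewrite /g; case: ifP => // _; rewrite mulr_ge0// ltW.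
have f0 z : 0 <= f z by rewrite fE; exact: sumr_ge0.
have -> : (r%:E * 'E_(Pr r)[fun w => f (Z r w)] =
    'E_(Pr r)[fun w => (r * f (Z r w))%R])%E.
  rewrite unlock -ge0_integralZl_EFin ?ltW//.
  - by move=> w _; rewrite lee_fin.
  - exact: (measurableT_comp (measurable_state (fun z => (f z)%:E))).
apply: (expectation_mean_le (f := fun z => r * f z)).
  by move=> z; rewrite mulr_ge0// ltW.
have rfE z : r * f z = \sum_a r * g a z by rewrite fE mulr_sumr.
rewrite (_ : (fun z => r * f z) = fun z => \sum_a r * g a z); last exact/funext.
rewrite mulr_suml; apply: mean_le_sum => [a z|a]; first by rewrite mulr_ge0// ltW.
rewrite /c /g; case: ifPn => [da|_]; last first.
  by rewrite mulr0 mul0r; exact: mean_le_cst.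
have sum0 (z : state J) : 0 <= r * (z a)%:R + mu a * (P z a * weighted_workload mu u z).
  by rewrite addr_ge0// mulr_ge0 ?mulr_ge0// ltW.
have := mean_leZ (ltW (v_gt0 (cls a))) sum0 (mean_slack_activity lam_gt0 mu_gt0
  rht rcrp vu_opt P_policy r_gt0 r_le sub C1_gt0 collapse r_small s0 sr da).
rewrite mulrA; apply: mean_le_mono => z; first by rewrite !mulr_ge0// ltW.
by rewrite mulrCA ler_pM2l// lerDl !mulr_ge0// ltW.
Qed.
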